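(* Let $(s_{1,1},\ldots,s_{1,m})=\mathcal{N}(\sigma_1,\ldots,\sigma_m)$ be a Nikishin system, ${\bf n}\in\mathbb{Z}_+^m$ with $n_1\ge\cdots\ge n_m$, $\ell\in\{1,\ldots,m\}$, and ${\bf n}^\ell={\bf n}+{\bf e}_\ell$ with ${\bf e}_\ell$ the $\ell$-th canonical vector. For ${\bf p}\in\{{\bf n},{\bf n}^\ell\}$ let $Q_{\bf p}$ be a type II Hermite–Padé polynomial of $(\widehat{s}_{1,1},\ldots,\widehat{s}_{1,m})$ for ${\bf p}$, with real coefficients, and define $\Psi_{{\bf p},0}=Q_{\bf p}$, $\Psi_{{\bf p},k}(z)=\int\frac{\Psi_{{\bf p},k-1}(x)}{z-x}d\sigma_k(x)$, $k=1,\ldots,m$. Then for each $k=0,\ldots,m-1$, $\Psi_{{\bf n}^\ell,k}$ has at most $n_{k+1}+\cdots+n_m+1$ zeros in $\mathbb{C}\setminus\Delta_k$ (with $\Delta_0=\emptyset$) and at least $n_{k+1}+\cdots+n_m$ sign changes in $\Delta_{k+1}$; therefore all its zeros in $\mathbb{C}\setminus\Delta_k$ are real and simple. The zeros of $\Psi_{{\bf n},k}$ and $\Psi_{{\bf n}^\ell,k}$ in $\mathbb{C}\setminus\Delta_k$ interlace.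
   Context: For a bounded interval $\Delta\subset\mathbb{R}$, $\mathcal{M}(\Delta)$ is the class of finite Borel measures of constant sign whose compact support consists of infinitely many points, is contained in $\mathbb{R}$, and has $\Delta$ as the smallest interval containing it. The Cauchy transform of a measure $s$ is $\widehat{s}(z)=\int\frac{ds(x)}{z-x}$. Nikishin system: let $\Delta_1,\ldots,\Delta_m$ be bounded real intervals with $\Delta_j\cap\Delta_{j+1}=\emptyset$ ($j=1,\ldots,m-1$), and $\sigma_j\in\mathcal{M}(\Delta_j)$ with $\mathrm{Co}(\operatorname{supp}\sigma_j)=\Delta_j$. For $1\le j\le k\le m$, $s_{j,j}=\sigma_j$ and $ds_{j,k}(x)=\widehat{s}_{j+1,k}(x)\,d\sigma_j(x)$ for $j<k$; $\mathcal{N}(\sigma_1,\ldots,\sigma_m)=(s_{1,1},\ldots,s_{1,m})$. Type II Hermite–Padé polynomial for ${\bf p}\in\mathbb{Z}_+^m$, $|{\bf p}|=p_1+\cdots+p_m$: a polynomial $Q_{\bf p}\not\equiv0$ with $\deg Q_{\bf p}\le|{\bf p}|$ such that for some polynomials $P_{{\bf p},j}$, $Q_{\bf p}(z)\widehat{s}_{1,j}(z)-P_{{\bf p},j}(z)=\mathcal{O}(1/z^{p_j+1})$ as $z\to\infty$, $j=1,\ldots,m$. *)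

(* Defs.v *)
From mathcomp Require Import all_boot all_order all_algebra.
From mathcomp Require Import all_classical all_reals all_analysis.
From mathcomp.real_closed Require Import complex.

Set Implicit Arguments.
Unset Strict Implicit.
Unset Printing Implicit Defensive.

Import Order.TTheory GRing.Theory Num.Theory.
Local Open Scope classical_set_scope.
Local Open Scope ring_scope.
Local Open Scope complex_scope.

Section NikishinDefs.
Context {R : realType}.

(* A finite Borel measure of constant sign sigma_j is represented as
   eps j * mu j, with mu j a finite positive Borel measure on R and eps j = 1 or -1. *)

Definition cint (mu : {finite_measure set R -> \bar R}) (f : R -> R[i]) : R[i] :=
  Complex (Rintegral mu setT (fun x => complex.Re (f x)))
          (Rintegral mu setT (fun x => complex.Im (f x))).

Definition ctrans (eps : nat -> R) (mu : nat -> {finite_measure set R -> \bar R})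
  (i : nat) (g : R[i] -> R[i]) : R[i] -> R[i] :=
  fun z => (eps i)%:C * cint (mu i) (fun x => g x%:C / (z - x%:C)).

(* Cauchy transform of s_{j,k}:  s_{k,k} = sigma_k,  ds_{j,k} = \hat s_{j+1,k} dsigma_j *)
Definition shat (eps : nat -> R) (mu : nat -> {finite_measure set R -> \bar R})
  (j k : nat) : R[i] -> R[i] :=
  foldr (fun i g => ctrans eps mu i g) (fun _ => 1) (iota j (k.+1 - j)).

Definition cpoly (Q : {poly R}) : R[i] -> R[i] :=
  fun z => (map_poly (real_complex R) Q).[z].

Definition Psi (eps : nat -> R) (mu : nat -> {finite_measure set R -> \bar R})
  (Q : {poly R}) (k : nat) : R[i] -> R[i] :=
  foldl (fun g i => ctrans eps mu i g) (cpoly Q) (iota 1 k).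

Definition msupport (mu : {finite_measure set R -> \bar R}) : set R :=
  [set x : R | forall e : R, 0 < e -> (0 < mu [set y : R | (x - e < y)%R && (y < x + e)%R])%E].

(* The data define a Nikishin system N(sigma_1,...,sigma_m) with
   Delta_j = [a j, b j] = Co(supp sigma_j). *)
Definition Nikishin_system (m : nat) (a b eps : nat -> R)
  (mu : nat -> {finite_measure set R -> \bar R}) : Prop :=
  (forall j, (1 <= j <= m)%N ->
     [/\ eps j = 1 \/ eps j = -1,
         infinite_set (msupport (mu j)),
         msupport (mu j) `<=` `[a j, b j] ,
         msupport (mu j) (a j) & msupport (mu j) (b j)]) /\
  (forall j, (1 <= j < m)%N -> b j < a j.+1 \/ b j.+1 < a j).

Definition absidx (m : nat) (p : nat -> nat) : nat := (\sum_(1 <= i < m.+1) p i)%N.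

Definition HP_typeII (m : nat) (eps : nat -> R)
  (mu : nat -> {finite_measure set R -> \bar R}) (p : nat -> nat) (Q : {poly R}) : Prop :=
  Q != 0 /\ (size Q <= (absidx m p).+1)%N /\
  forall j, (1 <= j <= m)%N ->
    exists P : {poly R[i]}, exists C M : R,
      forall z : R[i], M%:C < `|z| ->
        `|cpoly Q z * shat eps mu 1 j z - P.[z]| <= C%:C / `|z| ^+ (p j).+1.

Definition in_Delta (a b : nat -> R) (k : nat) (z : R[i]) : Prop :=
  (0 < k)%N /\ complex.Im z = 0 /\ a k <= complex.Re z <= b k.

Definition zeros_out (a b : nat -> R) (k : nat) (F : R[i] -> R[i]) : set R[i] :=
  [set z | ~ in_Delta a b k z /\ F z = 0].

Definition sign_changes_ge (f : R -> R) (c d : R) (N : nat) : Prop :=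
  exists x : nat -> R,
    (forall i, (i <= N)%N -> c <= x i <= d) /\
    (forall i, (i < N)%N -> x i < x i.+1 /\ f (x i) * f (x i.+1) < 0).

Definition interlace (A B : set R[i]) : Prop :=
  [/\ (forall z, A z -> complex.Im z = 0), (forall z, B z -> complex.Im z = 0),
      (forall z, A z -> ~ B z),
      (forall x y : R, A x%:C -> A y%:C -> x < y -> exists w : R, B w%:C /\ x < w < y) &
      (forall x y : R, B x%:C -> B y%:C -> x < y -> exists w : R, A w%:C /\ x < w < y)].

Definition incr_at (n : nat -> nat) (l : nat) : nat -> nat :=
  fun i => if i == l then (n i).+1 else n i.

End NikishinDefs.

(* Main.v *)
(** For an index p with p_j <= p_i + 1 whenever i < j (which covers both n and n^l),
    Fubini turns the Hermite-Pade conditions into: Psi_(k-1) is orthogonal to all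
    polynomials of degree < p_k with respect to sigma_k, for every k. If W is a real
    polynomial dividing Psi_k off Delta_k, then Psi_(k-1)/W is orthogonal to all
    polynomials of degree < p_k + deg W, so that Psi_(k-1) has p_k + deg W sign changes
    on Delta_k. Descending from Psi_m to Q bounds the number of zeros of each Psi_k by
    deg Q - (p_1 + ... + p_k), produces p_(k+1) + ... + p_m sign changes of Psi_k on
    Delta_(k+1), and shows deg Q_p = |p|. A nonreal or a double zero amounts to a
    quadratic W >= 0, which leaves all sign changes to the quotient Psi_k / W: that is
    one zero too many, even for any nontrivial combination of Q_n and Q_(n^l).
    Interlacing follows: all zeros lie in Delta_(k+1), and if Psi_(n,k) did not vanish
    between two zeros of Psi_(n^l,k), Rolle's theorem for the quotient would give a
    combination with a double zero (and similarly with the roles exchanged). *)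

Require Import Defs.
From mathcomp Require Import all_boot all_order all_algebra.
From mathcomp Require Import all_classical all_reals all_analysis.
From mathcomp.real_closed Require Import complex.
From mathcomp.real_closed Require polyrcf.
From mathcomp Require Import measurable_realfun.
From mathcomp Require Import ring lra.
Import Order.TTheory GRing.Theory Num.Theory.
Import numFieldNormedType.Exports.
Local Open Scope classical_set_scope.
Local Open Scope ring_scope.
Local Open Scope complex_scope.
Set Implicit Arguments.
Unset Strict Implicit.
Unset Printing Implicit Defensive.


(** * Integration against a measure carried by a segment *)

Section ConullIntegral.
Import HBNNSimple.

(** The functions integrated below are under control on [D] only, hence the generality in [f]. For
    [F >= 0] the integral is a supremum over simple functions below [F]; cutting such a function off
    outside [D] keeps its integral, since the complement is null. *)
Lemma integral_conull d (T : measurableType d) (R : realType)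
    (mu : {measure set T -> \bar R}) (D : set T) (f : T -> \bar R) :
  measurable D -> mu (~` D) = 0%E ->
  (\int[mu]_x f x = \int[mu]_(x in D) f x)%E.
Proof.
move=> mD D0.
suff H (F : T -> \bar R) : (forall x, (0 <= F x)%E) ->
    (\int[mu]_x F x = \int[mu]_(x in D) F x)%E.
  by rewrite integralE [RHS]integralE !H.
move=> F0; rewrite ge0_integralTE// ge0_integralE//.
apply/eqP; rewrite eq_le; apply/andP; split.
- apply: ge_ereal_sup => _ [h /= hF <-].
  apply: ereal_sup_ubound => /=; exists (proj_nnsfun h mD).
    move=> x; rewrite -mrestrict /patch; case: ifP => _; first exact: hF.
    by rewrite lexx.
  rewrite -mrestrict -integral_nnsfun//.
  have := @integral_nnsfun _ _ _ mu _ measurableT h; rewrite patch_setT => <-.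
  rewrite (@ge0_negligible_integral _ _ _ mu setT (~` D))//.
  + by rewrite setDE setCK setTI.
  + exact: measurableC.
  + apply/measurable_EFinP. exact: measurable_funPT.
  + by move=> x _; rewrite lee_fin; exact: fun_ge0.
- apply: ereal_sup_le => _ [h /= hF <-]; exists h => //= x.
  by apply: (le_trans (hF x)); rewrite /patch; case: ifP.
Qed.

End ConullIntegral.

Section IntegralOnSegment.
Context {R : realType}.
Variables (mu : {finite_measure set R -> \bar R}) (a b : R).
Hypothesis mu_ab : mu (~` `[a, b]) = 0%E.

(** Two-sided continuity is asked even at the end points: it is stable under the algebraic
    operations, and Psi_k has it on Delta_(k+1), which is disjoint from Delta_k. *)
Definition cont_on (f : R -> R) := forall x, a <= x <= b -> {for x, continuous f}.

Let mD : measurable (`[a, b] : set R). Proof. exact: measurable_itv. Qed.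

Lemma cont_on_within f : cont_on f -> {within `[a, b], continuous f}.
Proof.
move=> cf; apply: continuous_in_subspaceT => x /set_mem/=.
by rewrite in_itv/= => /cf.
Qed.

Lemma cont_on_measurable f : cont_on f -> measurable_fun (`[a, b] : set R) f.
Proof.
by move=> cf; apply: subspace_continuous_measurable_fun => //; exact: cont_on_within.
Qed.

Lemma cont_on_bounded f : cont_on f ->
  exists2 M, 0 <= M & forall x, a <= x <= b -> `|f x| <= M.
Proof.
move=> cf; have [lab|lba] := leP a b; last first.
  by exists 0 => // x /andP[/le_trans h /h]; rewrite leNgt lba.
have cn : {within `[a, b], continuous (fun x => `|f x|)}.
  apply: cont_on_within => x /cf cx.
  by apply: (@continuous_comp _ _ _ f Num.norm) => //; exact: norm_continuous.
have [c _ hc] := EVT_max lab cn.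
by exists (`|f c|) => // x hx; apply: hc; rewrite in_itv.
Qed.

Lemma cont_on_integrable f : cont_on f -> mu.-integrable `[a, b] (EFin \o f).
Proof.
move=> cf; apply: measurable_bounded_integrable => //.
- by rewrite -ge0_fin_numE//; exact: fin_num_measure.
- exact: cont_on_measurable.
- have [M M0 hM] := cont_on_bounded cf.
  exists M; split; first exact: ger0_real.
  move=> K MK x /=; rewrite in_itv/= => /hM h.
  exact: (le_trans h (ltW MK)).
Qed.

Lemma RintE f : Rintegral mu setT f = Rintegral mu `[a, b] f.
Proof. by rewrite /Rintegral (integral_conull _ mD). Qed.

Lemma Rint_ext f g : (forall x, a <= x <= b -> f x = g x) ->
  Rintegral mu setT f = Rintegral mu setT g.
Proof.
move=> fg; rewrite !RintE; apply: eq_Rintegral => x /set_mem /=.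
by rewrite in_itv/= => /fg.
Qed.

Lemma Rint0 : Rintegral mu setT (fun _ => 0) = 0.
Proof. by rewrite Rintegral_cst// mul0r. Qed.

Lemma RintD f g : cont_on f -> cont_on g ->
  Rintegral mu setT (fun x => f x + g x) = Rintegral mu setT f + Rintegral mu setT g.
Proof. by move=> cf cg; rewrite !RintE RintegralD//; exact: cont_on_integrable. Qed.

Lemma RintZ c f : cont_on f ->
  Rintegral mu setT (fun x => c * f x) = c * Rintegral mu setT f.
Proof. by move=> cf; rewrite !RintE RintegralZl//; exact: cont_on_integrable. Qed.

Definition mass := fine (mu `[a, b]%classic).

Lemma mass_ge0 : 0 <= mass. Proof. exact: fine_ge0. Qed.

Lemma Rint_bound f M : cont_on f -> (forall x, a <= x <= b -> `|f x| <= M) ->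
  `|Rintegral mu setT f| <= M * mass.
Proof.
move=> cf hM; rewrite RintE.
apply: (le_trans (le_normr_Rintegral mD (cont_on_integrable cf))).
rewrite -Rintegral_cst//; apply: le_Rintegral => //.
- by apply: integrable_norm; exact: cont_on_integrable.
- by apply: (@cont_on_integrable (fun=> M)) => x _; exact: cst_continuous.
Qed.

(** If [f] were positive at a support point, it would be nonzero on the part in [[a, b]] of a ball
    [V] around it; as a nonnegative function of integral zero vanishes almost everywhere, [V] would
    be null. *)
Lemma Rint_eq0 f : cont_on f -> (forall x, a <= x <= b -> 0 <= f x) ->
  Rintegral mu setT f = 0 ->
  forall x, msupport mu x -> a <= x <= b -> f x = 0.
Proof.
move=> cf f0 If x sx xab; apply/eqP; rewrite eq_le f0// andbT leNgt.
apply/negP => fx.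
have /cvgrPdist_lt /(_ _ (divr_gt0 fx (ltr0Sn R 1))) := cf x xab.
move=> /nbhs_ballP[e /= e0 he].
have Vm : measurable ([set y : R | (x - e < y) && (y < x + e)]).
  have -> : [set y : R | (x - e < y) && (y < x + e)] = `]x - e, x + e[%classic.
    by apply/seteqP; split=> y /=; rewrite in_itv.
  exact: measurable_itv.
set V := [set y : R | _] in Vm.
have VD0 : mu (V `&` ~` `[a, b]) = 0%E.
  apply: (subset_measure0 _ _ _ mu_ab) => //; last exact: measurableC.
  by apply: measurableI => //; exact: measurableC.
suff VD : mu (V `&` `[a, b]%classic) = 0%E.
  have V0 : mu V = 0%E.
    rewrite (measureDI mu Vm (measurableC mD)) -[RHS]adde0.
    by congr (_ + _)%E; [rewrite setDE setCK|].
  by have := sx e e0; rewrite -/V V0 ltxx.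
have fm := cont_on_measurable cf.
have : (\int[mu]_(x in `[a, b]) `|(EFin \o f) x| = 0)%E.
  rewrite (eq_integral (EFin \o f)); last first.
    by move=> y /set_mem /=; rewrite in_itv/= => /f0 h; rewrite ger0_norm.
  by rewrite -[LHS]fineK ?(integrable_fin_num _ (cont_on_integrable cf))// -/(Rintegral _ _ _) -RintE If.
move/(ae_eq_integral_abs mu mD ((measurable_EFinP _ _).2 fm)) => [N [mN N0 hN]].
apply: (subset_measure0 _ _ _ N0) => //; first exact: measurableI.
move=> y [Vy Dy]; apply: hN => /=; apply/not_implyP; split => //= -[fy0].
have := he y; rewrite /ball/= ltr_distlC => /(_ Vy).
by rewrite fy0 subr0 gtr0_norm// ltr_pdivlMr// mulr_natr mulr2n gtrDl ltNge ltW.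
Qed.

End IntegralOnSegment.

(** A point outside the support has a null neighbourhood, which may be taken to be an interval with
    rational end points; there are countably many of these, enumerated through [unpickle]. *)
Lemma msupport_conull (R : realType) (mu : {finite_measure set R -> \bar R}) (a b : R) :
  msupport mu `<=` `[a, b] -> mu (~` `[a, b]) = 0%E.
Proof.
move=> sab; have mD : measurable (~` `[a, b]%classic : set R).
  by apply: measurableC; exact: measurable_itv.
pose J (p : rat * rat) : set R := `]ratr p.1, ratr p.2[%classic.
pose F (i : nat) : set R :=
  if unpickle i is Some p then if mu (J p) == 0%E then J p else set0 else set0.
have nF i : mu.-negligible (F i).
  rewrite /F; case: (unpickle i) => [p|]; last exact: negligible_set0.
  case: eqP => [p0|_]; last exact: negligible_set0.
  by exists (J p); split => //; exact: measurable_itv.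
have [N [mN N0 hN]] := negligible_bigcup nF.
apply: (subset_measure0 _ _ _ N0) => // x xab; apply: hN.
have /existsNP[e /not_implyP[e0 xe]] : ~ msupport mu x by move=> /sab.
have h1 : x - e < x by rewrite gtrBl.
have [q1] := rat_in_itvoo h1.
rewrite in_itv/= => /andP[q1l q1r].
have h2 : x < x + e by rewrite ltrDl.
have [q2] := rat_in_itvoo h2.
rewrite in_itv/= => /andP[q2l q2r].
exists (pickle (q1, q2)); first exact: I.
rewrite /F pickleK.
have -> : mu (J (q1, q2)) = 0%E.
  apply/eqP; move/negP: xe; rewrite -leNgt => xe; rewrite eq_le measure_ge0 andbT.
  apply: le_trans xe; apply: le_measure; rewrite ?inE/=; [exact: measurable_itv| |].
    have -> : [set y : R | (x - e < y) && (y < x + e)] = `]x - e, x + e[%classic.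
      by apply/seteqP; split=> y /=; rewrite in_itv.
    exact: measurable_itv.
  rewrite /J => y /=; rewrite in_itv/= => /andP[ly yu].
  by rewrite (lt_trans q1l ly) (lt_trans yu q2r).
by rewrite eqxx /J/= in_itv/= q1r q2l.
Qed.

(** * Exchange of integrals for the Cauchy kernel on two disjoint segments *)

Section FubiniCauchyKernel.
Context {R : realType}.
Variables (mu nu : {finite_measure set R -> \bar R}) (a b c d : R).
Hypotheses (mu_ab : mu (~` `[a, b]) = 0%E) (nu_cd : nu (~` `[c, d]) = 0%E).

(** Because of the convention that 0 has inverse 0, the inverse equals its own restriction to the
    open set of nonzero reals, where it is continuous. *)
Lemma measurable_invr : measurable_fun setT (@GRing.inv R).
Proof.
have -> : @GRing.inv R = @GRing.inv R \_ (~` [set 0]).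
  apply/funext => x; rewrite /patch; case: ifPn => //; rewrite notin_setE/= => /contrapT ->.
  by rewrite invr0.
apply/(measurable_restrictT _ (measurableC (measurable_set1 0))).
apply: open_continuous_measurable_fun.
  by apply: closed_openC; apply: accessible_closed_set1; apply: hausdorff_accessible; exact: Rhausdorff.
by move=> x /set_mem /= /eqP x0; exact: inv_continuous.
Qed.

Hypothesis sep : b < c \/ d < a.

Lemma sep_neq t x : a <= t <= b -> c <= x <= d -> x - t != 0.
Proof.
move=> /andP[at_ tb] /andP[cx xd]; rewrite subr_eq0; apply/eqP => xt.
case: sep; first by rewrite ltNge (le_trans cx)// xt.
by rewrite ltNge (le_trans at_)// -xt.
Qed.

Lemma sep_far : exists2 r, 0 < r & forall t x, a <= t <= b -> c <= x <= d -> r <= `|x - t|.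
Proof.
case: sep => h.
- exists (c - b); first by rewrite subr_gt0.
  move=> t x /andP[at_ tb] /andP[cx xd]; apply: le_trans (ler_norm _).
  by rewrite lerB.
- exists (a - d); first by rewrite subr_gt0.
  move=> t x /andP[at_ tb] /andP[cx xd]; rewrite distrC; apply: le_trans (ler_norm _).
  by rewrite lerB.
Qed.

Lemma cont_on_kernel_l (f : R -> R) x : cont_on a b f -> c <= x <= d ->
  cont_on a b (fun t => f t / (x - t)).
Proof.
move=> cf xcd t tab; apply: continuousM; first exact: cf.
apply: continuousV; first exact: sep_neq.
by apply: continuousB; [exact: cst_continuous|exact: cvg_id].
Qed.

Lemma cont_on_kernel_r (g : R -> R) t : cont_on c d g -> a <= t <= b ->
  cont_on c d (fun x => g x / (x - t)).
Proof.
move=> cg tab x xcd; apply: continuousM; first exact: cg.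
apply: continuousV; first exact: sep_neq.
by apply: continuousB; [exact: cvg_id|exact: cst_continuous].
Qed.

Lemma Fubini_Cauchy (f g : R -> R) : cont_on a b f -> cont_on c d g ->
  Rintegral nu setT (fun x => g x * Rintegral mu setT (fun t => f t / (x - t))) =
  Rintegral mu setT (fun t => f t * Rintegral nu setT (fun x => g x / (x - t))).
Proof.
move=> cf cg.
have mab : measurable (`[a, b]%classic : set R) by exact: measurable_itv.
have mcd : measurable (`[c, d]%classic : set R) by exact: measurable_itv.
(* Truncating [f] and [g] to their segments makes the integrand measurable on the whole plane, and
   bounded because the segments lie at a positive distance. *)
pose K (p : R * R) : R := (f \_ `[a, b]) p.1 * (g \_ `[c, d]) p.2 * (p.2 - p.1)^-1.
have mK : measurable_fun setT K.
  apply: measurable_funM; first apply: measurable_funM.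
  - apply: (measurableT_comp (f := f \_ `[a, b])) => //.
    by apply/(measurable_restrictT _ mab); exact: cont_on_measurable.
  - apply: (measurableT_comp (f := g \_ `[c, d])) => //.
    by apply/(measurable_restrictT _ mcd); exact: cont_on_measurable.
  - apply: (measurableT_comp measurable_invr).
    by apply: measurable_funB => //.
have [Mf Mf0 hf] := cont_on_bounded cf.
have [Mg Mg0 hg] := cont_on_bounded cg.
have [r r0 hr] := sep_far.
have iK : (mu \x nu)%E.-integrable setT (EFin \o K).
  apply: measurable_bounded_integrable => //.
  - rewrite [X in (X < _)%E](_ : _ = (mu setT * nu setT)%E); last first.
      by rewrite -setXTT; exact: product_measure1E.
    apply: lte_mul_pinfty => //.
    + exact: fin_num_measure.
    + by rewrite -ge0_fin_numE//; exact: fin_num_measure.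
  - exists (Mf * Mg * r^-1); split; first exact: num_real.
    move=> M MM [t x] _; apply: le_trans (ltW MM); rewrite /K/= /patch.
    have B0 : 0 <= Mf * Mg * r^-1 by rewrite !mulr_ge0// invr_ge0 ltW.
    case: ifPn => [/set_mem/=|]; last by rewrite !mul0r normr0.
    rewrite in_itv/= => tab.
    case: ifPn => [/set_mem/=|]; last by rewrite mulr0 mul0r normr0.
    rewrite in_itv/= => xcd.
    rewrite !normrM normfV; apply: ler_pM; rewrite ?mulr_ge0 ?invr_ge0//.
    + by apply: ler_pM => //; [exact: hf|exact: hg].
    + by rewrite lef_pV2 ?posrE// ?hr// (lt_le_trans r0)// hr.
have innu x : c <= x <= d ->
    (\int[mu]_t (K (t, x))%:E = (g x * Rintegral mu setT (fun t => f t / (x - t)))%:E)%E.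
  move=> xcd; rewrite -(RintZ mu_ab _ (cont_on_kernel_l cf xcd)) (RintE mu_ab).
  rewrite (integral_conull _ mab mu_ab) /Rintegral fineK; last first.
    apply: integrable_fin_num => //.
    apply: (@cont_on_integrable _ _ _ _ (fun t => g x * (f t / (x - t)))) => t tab.
    by apply: continuousM; [exact: cst_continuous|exact: cont_on_kernel_l].
  apply: eq_integral => t /[dup] tD /set_mem/=; rewrite in_itv/= => tab.
  have xD : x \in `[c, d]%classic by apply/mem_set; rewrite /= in_itv.
  rewrite /K/= patchE tD patchE xD.
  by rewrite mulrA (mulrC (f t)).
have inmu t : a <= t <= b ->
    (\int[nu]_x (K (t, x))%:E = (f t * Rintegral nu setT (fun x => g x / (x - t)))%:E)%E.
  move=> tab; rewrite -(RintZ nu_cd _ (cont_on_kernel_r cg tab)) (RintE nu_cd).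
  rewrite (integral_conull _ mcd nu_cd) /Rintegral fineK; last first.
    apply: integrable_fin_num => //.
    apply: (@cont_on_integrable _ _ _ _ (fun x => f t * (g x / (x - t)))) => x xcd.
    by apply: continuousM; [exact: cst_continuous|exact: cont_on_kernel_r].
  apply: eq_integral => x /[dup] xD /set_mem/=; rewrite in_itv/= => xcd.
  have tD : t \in `[a, b]%classic by apply/mem_set; rewrite /= in_itv.
  rewrite /K/= [(g \_ _) x]patchE xD patchE tD.
  by rewrite mulrA.
rewrite /Rintegral; congr fine.
rewrite (integral_conull _ mcd nu_cd) [RHS](integral_conull _ mab mu_ab).
transitivity (\int[nu]_(x in `[c, d]) \int[mu]_t (K (t, x))%:E)%E.
  by apply: eq_integral => x /set_mem/=; rewrite in_itv/= => /innu ->.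
transitivity (\int[mu]_(t in `[a, b]) \int[nu]_x (K (t, x))%:E)%E; last first.
  by apply: eq_integral => x /set_mem/=; rewrite in_itv/= => /inmu ->.
by rewrite -(integral_conull _ mcd nu_cd) -(integral_conull _ mab mu_ab) (Fubini iK).
Qed.
End FubiniCauchyKernel.

(** * Sign changes of continuous functions, and polynomials of matching sign *)

Section SignAlternation.
Context {R : realType}.
Implicit Types (f : R -> R) (a b s : R).

(** Here [D] counts points, that is one more than the number of sign changes, which is what
    [sign_changes_ge] counts; [s] is the sign at the first point. *)
Definition alternates f s a b D := exists x : nat -> R,
  (forall i, (i < D)%N -> a <= x i <= b /\ 0 < s * (-1) ^+ i * f (x i)) /\
  (forall i, (i.+1 < D)%N -> x i < x i.+1).

Lemma alternates_cons f s a b D t (x : nat -> R) :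
  (forall i, (i < D)%N -> a <= x i <= b /\ 0 < - s * (-1) ^+ i * f (x i)) ->
  (forall i, (i.+1 < D)%N -> x i < x i.+1) ->
  a <= t <= b -> 0 < s * f t -> ((0 < D)%N -> t < x 0%N) ->
  alternates f s a b D.+1.
Proof.
move=> hx sx tab ft tx; exists (fun i => if i is j.+1 then x j else t); split.
  case=> [|i]; first by rewrite mulr1.
  by rewrite ltnS => /hx[? h]; split => //; rewrite exprS mulN1r mulrN -mulNr.
by case=> [|i]; rewrite ltnS; [exact: tx|exact: sx].
Qed.

(* The roots of P are the infima of the successive sets where f has the next sign;
   the last clause, the sign of P to the left of [a, b], drives the induction on D. *)
Lemma alternates_or_poly f D s a b : a <= b -> cont_on a b f ->
  (s = 1 \/ s = -1) ->
  alternates f s a b D.+1 \/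
  exists P : {poly R}, [/\ P != 0, (size P <= D.+1)%N,
    forall t, a <= t <= b -> 0 <= f t * P.[t] &
    forall t, t <= a -> 0 <= - s * P.[t]].
Proof.
elim: D s a => [|D IH] s a lab cf hs.
  have [[t [tab ft]]|nt] := pselect (exists t, a <= t <= b /\ 0 < s * f t).
    by left; apply: (@alternates_cons _ _ _ _ 0 t (fun=> t)).
  have ss : s * s = 1 by case: hs => ->; rewrite ?mulrNN mulr1.
  right; exists (- s)%:P; split.
  - by rewrite polyC_eq0 oppr_eq0; case: hs => ->; rewrite ?oppr_eq0 oner_eq0.
  - exact: size_polyC_leq1.
  - move=> t tab; rewrite hornerC mulrN oppr_ge0 leNgt mulrC; apply/negP => ft.
    by apply: nt; exists t.
  - by move=> t _; rewrite hornerC mulrNN ss.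
have [[t0 [t0ab ft0]]|nt] := pselect (exists t, a <= t <= b /\ 0 < s * f t); last first.
  have ss : s * s = 1 by case: hs => ->; rewrite ?mulrNN mulr1.
  right; exists (- s)%:P; split.
  - by rewrite polyC_eq0 oppr_eq0; case: hs => ->; rewrite ?oppr_eq0 oner_eq0.
  - exact: leq_trans (size_polyC_leq1 _) _.
  - move=> t tab; rewrite hornerC mulrN oppr_ge0 leNgt mulrC; apply/negP => ft.
    by apply: nt; exists t.
  - by move=> t _; rewrite hornerC mulrNN ss.
pose S : set R := [set t | a <= t <= b /\ 0 < s * f t].
have Sinf : has_inf S by split; [exists t0|exists a => t [/andP[]]].
pose c := inf S.
have ac : a <= c by apply: lb_le_inf; [exists t0|move=> t [/andP[]]].
have cS t : S t -> c <= t by move=> St; apply: ge_inf => //; case: Sinf.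
have cb : c <= b by apply: (le_trans (cS t0 _)) => //; case/andP: t0ab.
have below t : a <= t < c -> s * f t <= 0.
  move=> /andP[at_ tc]; rewrite leNgt; apply/negP => ft.
  have := cS t; rewrite leNgt tc => h; have : false by apply: h; split => //; rewrite at_ (le_trans (ltW tc)).
  by [].
have Sright x : c < x -> exists2 t, S t & t < x.
  by move=> cx; have [t St tx] := inf_lt Sinf.1 cx; exists t.
have hns : - s = 1 \/ - s = -1 by case: hs => ->; [right|left]; rewrite ?opprK.
have cfc : cont_on c b f by move=> t /andP[ct tb]; apply: cf; rewrite tb (le_trans ac).
case: (IH (- s) c cb cfc hns) => [[x [hx sx]]|[P [P0 sP fP Pl]]].
- left; have [xab0 fx0] := hx 0%N isT.
  have hx' i : (i < D.+1)%N -> a <= x i <= b /\ 0 < - s * (-1) ^+ i * f (x i).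
    by move=> /hx[/andP[h1 h2] h3]; split => //; rewrite h2 (le_trans ac).
  (* The first point cannot be [c]: otherwise [- s * f] would be positive at [c], hence on an
     interval around [c], and such an interval contains points of [S]. *)
  have cx0 : c < x 0%N.
    rewrite lt_neqAle; case/andP: (xab0) => -> _; rewrite andbT.
    apply/eqP => cx; move: fx0; rewrite mulr1 -cx => fc.
    have cc : {for c, continuous (fun y => - s * f y)}.
      apply: continuousM; first exact: cst_continuous.
      by apply: cf; rewrite ac.
    have /cvgrPdist_lt /(_ _ fc) /nbhs_ballP[e /= e0 he] := cc.
    have [t St tx] := Sright (c + e) (ltac:(by rewrite ltrDl)).
    have := he t; rewrite /ball/= distrC ger0_norm ?subr_ge0 ?cS// ltrBlDl => /(_ tx).
    move=> h; have := ler_norm (- s * f c - - s * f t).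
    case: St => _ ft /le_lt_trans /(_ h); rewrite mulNr.
    by rewrite mulNr opprK gtrDl ltNge (ltW ft).
  have [t [tab ft] tx] := Sright _ cx0.
  exact: (@alternates_cons _ _ _ _ _ t x).
- right; exists (('X - c%:P) * P); split.
  + by rewrite mulf_neq0// polyXsubC_eq0.
  + by rewrite mulrC size_Mmonic ?monicXsubC// size_XsubC addn2.
  + move=> t /andP[at_ tb]; rewrite hornerM hornerXsubC mulrCA.
    have [tc|ct] := ltP t c; last first.
      by rewrite mulr_ge0 ?subr_ge0// fP// ct.
    rewrite -mulrNN mulr_ge0// ?oppr_ge0 ?subr_le0 ?(ltW tc)//.
    have h1 := below t; rewrite at_ tc in h1; have := Pl t (ltW tc); rewrite opprK.
    move: (h1 isT); case: hs => ->; rewrite ?mul1r ?mulN1r ?oppr_le0 ?oppr_ge0 => f1 p1.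
      exact: mulr_le0_ge0.
    exact: mulr_ge0_le0.
  + move=> t ta; rewrite hornerM hornerXsubC mulrCA.
    have tc := le_trans ta ac.
    by rewrite -mulrNN mulr_ge0// ?oppr_ge0 ?subr_le0//; have := Pl t tc; rewrite opprK mulNr oppr_le0.
Qed.

(* An alternation starting with + and one starting with -, each on D points, combine
   into one on D+1 points: prepend to one of them the first point of the other. *)
Lemma sign_changes_or_poly f D a b : a <= b -> cont_on a b f -> (0 < D)%N ->
  sign_changes_ge f a b D \/
  exists P : {poly R}, [/\ P != 0, (size P <= D)%N &
    forall t, a <= t <= b -> 0 <= f t * P.[t]].
Proof.
case: D => // D lab cf _.
have alt_signs s : (s = 1 \/ s = -1) -> alternates f s a b D.+2 -> sign_changes_ge f a b D.+1.
  move=> hs [x [hx sx]]; exists x; split; first by move=> i /hx[].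
  move=> i iD; split; first exact: sx.
  have [_ h1] := hx i (ltac:(by rewrite ltnS ltnW)).
  have [_ h2] := hx i.+1 iD.
  have := mulr_gt0 h1 h2; rewrite exprS.
  have -> : s * (-1) ^+ i * f (x i) * (s * (-1 * (-1) ^+ i) * f (x i.+1)) =
     - ((s * s) * ((-1) ^+ i * (-1) ^+ i) * (f (x i) * f (x i.+1))) by ring.
  rewrite -(expr2 ((-1) ^+ i)) sqrr_sign mulr1; by case: hs => ->; rewrite ?mulrNN !mul1r oppr_gt0.
have := alternates_or_poly D lab cf (or_introl (erefl 1)).
case=> [[x [hx sx]]|[P [P0 sP fP _]]]; last by right; exists P.
have := alternates_or_poly D lab cf (or_intror (erefl (-1))).
case=> [[y [hy sy]]|[P [P0 sP fP _]]]; last by right; exists P.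
left; have [x0ab fx0] := hx 0%N isT; have [y0ab fy0] := hy 0%N isT.
have [xy|xy|xy] := ltgtP (x 0%N) (y 0%N).
- apply: (alt_signs 1); first by left.
  by apply: (@alternates_cons _ _ _ _ _ (x 0%N) y) => //; move: fx0; rewrite mulr1.
- apply: (alt_signs (-1)); first by right.
  apply: (@alternates_cons _ _ _ _ _ (y 0%N) x) => //; last by move: fy0; rewrite mulr1.
  by rewrite opprK.
- move: fx0 fy0; rewrite xy !mulr1 mul1r mulN1r oppr_gt0 => h1 h2.
  by have := lt_trans h1 h2; rewrite ltxx.
Qed.

Lemma sign_changes_zeros f D a b : cont_on a b f -> sign_changes_ge f a b D ->
  exists s : seq R, [/\ uniq s, size s = D & forall x, x \in s -> a <= x <= b /\ f x = 0].
Proof.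
move=> cf [x [xab hx]].
(* The induction also records that the zeros lie to the left of the last point; the next zero, found
   strictly to its right, is then a new one. *)
suff [s [us ss hs]] : exists s : seq R, [/\ uniq s, size s = D &
    forall y, y \in s -> [/\ a <= y <= b, f y = 0 & y < x D]].
  by exists s; split => // y /hs[].
elim: D xab hx => [|D IH] xab hx; first by exists [::].
have [s [us ss hs]] := IH (fun i iD => xab i (leqW iD)) (fun i iD => hx i (leqW iD)).
have [xx fx] := hx D (ltnSn D).
have /andP[ax xb] := xab D (leqnSn D).
have /andP[ax' xb'] := xab D.+1 (leqnn _).
have cw : {within `[x D, x D.+1], continuous f}.
  apply: cont_on_within => y /andP[h1 h2]; apply: cf.
  by rewrite (le_trans ax)// (le_trans h2).
have [|c] := @IVT _ f _ _ 0 (ltW xx) cw.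
  rewrite ge_min le_max.
  have [f0|f0|f0] := ltgtP (f (x D)) 0.
  - by move: fx; rewrite nmulr_rlt0// => /ltW ->; rewrite orbT.
  - by move: fx; rewrite pmulr_rlt0// => /ltW ->; rewrite orbT.
  - by move: fx; rewrite f0 mul0r ltxx.
rewrite in_itv/= => /andP[h1 h2] fc.
have xc : x D < c.
  rewrite lt_neqAle h1 andbT; apply/eqP => xc.
  by move: fx; rewrite xc fc mul0r ltxx.
have cx : c < x D.+1.
  rewrite lt_neqAle h2 andbT; apply/eqP => cx.
  by move: fx; rewrite -cx fc mulr0 ltxx.
exists (c :: s); split => //=; last 1 first.
- move=> y; rewrite inE => /predU1P[->|/hs[h3 h4 h5]]; split => //.
    by rewrite (le_trans ax)// (le_trans h2).
  exact: lt_trans h5 xx.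
- by rewrite us andbT; apply/negP => /hs[_ _]; rewrite ltNge ltW.
- by rewrite ss.
Qed.
End SignAlternation.

(** * Cauchy transforms at real points off the segment *)

Lemma is_derive_factor (R : realType) (F G : R -> R) (w : R) :
  (\forall z \near w, F z = F w + G z * (z - w)) -> {for w, continuous G} ->
  is_derive w 1 F (G w).
Proof.
move=> FG cG; apply/is_derive1_caratheodory.
exists (fun z => if z == w then G w else (F z - F w) / (z - w)); split.
- by move=> z; case: eqP => [->|/eqP zw]; rewrite ?subrr ?mulr0// divfK// subr_eq0.
- rewrite /prop_for /= /continuous_at eqxx; apply: cvg_trans cG; apply: near_eq_cvg; near=> z.
  case: eqP => [->//|/eqP zw].
  have -> : F z = F w + G z * (z - w) by near: z.
  by rewrite (addrC (F w)) addrK mulfK// subr_eq0.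
- by rewrite eqxx.
Unshelve. all: by end_near.
Qed.

Section ContOn.
Context {R : realType}.
Variables a b : R.
Local Notation cont_on := (cont_on a b).
Implicit Types (f g : R -> R) (P : {poly R}).

Lemma cont_on_poly P : cont_on (fun x => P.[x]).
Proof. by move=> x _; exact: continuous_horner. Qed.

Lemma cont_on_cst c : cont_on (fun=> c).
Proof. by move=> x _; exact: cst_continuous. Qed.

Lemma cont_onM f g : cont_on f -> cont_on g -> cont_on (fun x => f x * g x).
Proof. by move=> cf cg x xab; apply: continuousM; [exact: cf|exact: cg]. Qed.

Lemma cont_onD f g : cont_on f -> cont_on g -> cont_on (fun x => f x + g x).
Proof. by move=> cf cg x xab; apply: continuousD; [exact: cf|exact: cg]. Qed.

Lemma cont_on_divp f P : cont_on f -> (forall x, a <= x <= b -> P.[x] != 0) ->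
  cont_on (fun x => f x / P.[x]).
Proof.
move=> cf P0 x xab; apply: continuousM; first exact: cf.
by apply: continuousV; [exact: P0|exact: continuous_horner].
Qed.

Lemma off_gap z : ~~ (a <= z <= b) ->
  exists2 e, 0 < e & forall x, a <= x <= b -> e <= `|z - x|.
Proof.
rewrite negb_and -!ltNge => /orP[za|bz].
- exists (a - z); first by rewrite subr_gt0.
  move=> x /andP[ax _]; rewrite distrC; apply: le_trans (ler_norm _).
  by rewrite lerB.
- exists (z - b); first by rewrite subr_gt0.
  move=> x /andP[_ xb]; apply: le_trans (ler_norm _).
  by rewrite lerB.
Qed.

Lemma off_sub_neq0 z x : ~~ (a <= z <= b) -> a <= x <= b -> z - x != 0.
Proof. by move=> zab xab; rewrite subr_eq0; apply: contraNneq zab => ->. Qed.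

Lemma cont_on_kernel f z : cont_on f -> ~~ (a <= z <= b) ->
  cont_on (fun x => f x / (z - x)).
Proof.
move=> cf zab x xab; apply: continuousM; first exact: cf.
apply: continuousV; first exact: off_sub_neq0.
by apply: continuousB; [exact: cst_continuous|exact: cvg_id].
Qed.

End ContOn.

Section CauchyTransform.
Context {R : realType}.
Variables (mu : {finite_measure set R -> \bar R}) (a b : R).
Hypothesis mu_ab : mu (~` `[a, b]) = 0%E.
Local Notation cont_on := (cont_on a b).
Implicit Types (f g : R -> R) (P : {poly R}).

Definition Cauchy f z : R := Rintegral mu setT (fun x => f x / (z - x)).

Lemma Cauchy_ext f g z : (forall x, a <= x <= b -> f x = g x) ->
  Cauchy f z = Cauchy g z.
Proof. by move=> fg; apply: (Rint_ext mu_ab) => x /fg ->. Qed.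

Lemma CauchyD f g z : cont_on f -> cont_on g -> ~~ (a <= z <= b) ->
  Cauchy (fun x => f x + g x) z = Cauchy f z + Cauchy g z.
Proof.
move=> cf cg zab; rewrite /Cauchy -(RintD mu_ab); try exact: cont_on_kernel.
by apply: (Rint_ext mu_ab) => x _; rewrite mulrDl.
Qed.

Lemma CauchyZ c f z : cont_on f -> ~~ (a <= z <= b) ->
  Cauchy (fun x => c * f x) z = c * Cauchy f z.
Proof.
move=> cf zab; rewrite /Cauchy -(RintZ mu_ab); last exact: cont_on_kernel.
by apply: (Rint_ext mu_ab) => x _; rewrite mulrA.
Qed.

(** From x/(z - x) = z/(z - x) - 1. *)
Lemma Cauchy_mulX f z : cont_on f -> ~~ (a <= z <= b) ->
  Cauchy (fun x => f x * x) z = z * Cauchy f z - Rintegral mu setT f.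
Proof.
move=> cf zab; apply/eqP; rewrite eq_sym subr_eq eq_sym; apply/eqP.
rewrite /Cauchy -(RintD mu_ab) //; last first.
  apply: (@cont_on_kernel _ _ _ (fun x => f x * x)) => //.
  by apply: cont_onM => // x _; exact: cvg_id.
rewrite -(RintZ mu_ab); last exact: cont_on_kernel.
apply: (Rint_ext mu_ab) => x xab.
have h := off_sub_neq0 zab xab; by field.
Qed.

(** The polynomial [Q(z)] is the integral of f(x)(P(z) - P(x))/(z - x), whose degree in z is below
    that of [P]; it is built along Horner's scheme from [Cauchy_mulX]. *)
Lemma Cauchy_mul_poly f P : cont_on f -> exists Q : {poly R},
  (size Q <= (size P).-1)%N /\ forall z, ~~ (a <= z <= b) ->
  Cauchy (fun x => f x * P.[x]) z = P.[z] * Cauchy f z - Q.[z].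
Proof.
move=> cf; elim/poly_ind: P => [|P c [Q [sQ hQ]]].
  exists 0; split; first by rewrite size_poly0.
  move=> z zab; rewrite !horner0 mul0r subr0.
  rewrite (@Cauchy_ext _ (fun=> 0)); last by move=> x _; rewrite horner0 mulr0.
  rewrite /Cauchy (Rint_ext mu_ab (g := fun=> 0)) ?(Rint0 mu)// => x _.
  by rewrite mul0r.
have cP : cont_on (fun x => f x * P.[x]) by apply: cont_onM => //; exact: cont_on_poly.
exists (Q * 'X + (Rintegral mu setT (fun x => f x * P.[x]))%:P); split.
  have [P0|P0] := eqVneq P 0.
    have /size_poly_leq0P -> : (size Q <= 0)%N by move: sQ; rewrite P0 size_poly0.
    rewrite P0 !mul0r !add0r; have -> : Rintegral mu setT (fun x => f x * (0 : {poly R}).[x]) = 0.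
      by rewrite -[RHS](Rint0 mu); apply: (Rint_ext mu_ab) => x _; rewrite horner0 mulr0.
    by rewrite size_poly0.
  rewrite (size_MXaddC P) (negPf P0)/= size_MXaddC.
  case: ifP => // _; apply: (leq_ltn_trans sQ).
  by rewrite ltn_predL size_poly_gt0.
move=> z zab; rewrite !hornerMXaddC.
rewrite (@Cauchy_ext _ (fun x => (f x * P.[x]) * x + c * f x)); last first.
  by move=> x _; rewrite hornerMXaddC; ring.
rewrite CauchyD//; last 2 first.
  by apply: cont_onM => // x _; exact: cvg_id.
  by apply: cont_onM => //; exact: cont_on_cst.
by rewrite Cauchy_mulX// CauchyZ// hQ//; ring.
Qed.

(** The constant [B] does not depend on the point: with [e] fixed this gives local bounds, with [e]
    of the order of z it gives decay at infinity. *)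
Lemma Cauchy_bounded f : cont_on f -> exists2 B, 0 <= B &
  forall z e, 0 < e -> (forall x, a <= x <= b -> e <= `|z - x|) -> `|Cauchy f z| <= B / e.
Proof.
move=> cf; have [M M0 hM] := cont_on_bounded cf.
exists (M * mass mu a b); first by rewrite mulr_ge0// mass_ge0.
move=> z e e0 he.
have zab : ~~ (a <= z <= b).
  by apply/negP => /he; rewrite subrr normr0 leNgt e0.
rewrite mulrAC; apply: (Rint_bound mu_ab); first exact: cont_on_kernel.
move=> x xab; rewrite normrM normfV; apply: ler_pM; rewrite ?invr_ge0//.
  exact: hM.
by rewrite lef_pV2 ?posrE ?he// (lt_le_trans e0)// he.
Qed.

(** This is the resolvent identity of the Cauchy kernel. Continuity, differentiability and division
    by X - w at a zero w all come from it. *)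
Lemma Cauchy_sub f z w : cont_on f -> ~~ (a <= z <= b) -> ~~ (a <= w <= b) ->
  Cauchy f z - Cauchy f w = - Cauchy (fun x => f x / (w - x)) z * (z - w).
Proof.
move=> cf zab wab; rewrite mulNr mulrC -mulNr opprB.
rewrite -CauchyZ//; last exact: cont_on_kernel.
apply/eqP; rewrite subr_eq; apply/eqP; rewrite /Cauchy.
rewrite -(RintD mu_ab); last exact: cont_on_kernel; last first.
  apply: (@cont_on_kernel _ _ _ (fun x => (w - z) * (f x / (w - x)))) => //.
  by apply: cont_onM; [exact: cont_on_cst|exact: cont_on_kernel].
apply: (Rint_ext mu_ab) => x xab.
have h1 := off_sub_neq0 zab xab; have h2 := off_sub_neq0 wab xab.
by field; rewrite h1 h2.
Qed.

Lemma Cauchy_continuous f w : cont_on f -> ~~ (a <= w <= b) ->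
  {for w, continuous (Cauchy f)}.
Proof.
move=> cf wab; have [e e0 he] := off_gap wab.
have [B B0 hB] := Cauchy_bounded (cont_on_kernel cf wab).
have e20 : 0 < e / 2 by rewrite divr_gt0.
have far z : `|w - z| < e / 2 -> forall x, a <= x <= b -> e / 2 <= `|z - x|.
  move=> wz x /he h; have := ler_distD z w x; lra.
apply/cvgrPdist_lt => d d0; apply/nbhs_ballP.
(* The added 1 keeps [C] positive when [B] is zero. *)
pose C := B / (e / 2) + 1.
have C0 : 0 < C by rewrite ltr_wpDl// divr_ge0// ltW.
exists (Num.min (e / 2) (d / C)) => /=.
  by rewrite lt_min e20 divr_gt0.
move=> z; rewrite /ball/= lt_min => /andP[h1 h2].
have zab : ~~ (a <= z <= b).
  by apply/negP => /(far z h1); rewrite subrr normr0 leNgt e20.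
rewrite distrC Cauchy_sub// normrM normrN (distrC z).
have := hB z _ e20 (far z h1) => hz.
apply: (@le_lt_trans _ _ (C * `|w - z|)).
  by rewrite ler_wpM2r// (le_trans hz)// lerDl.
by rewrite mulrC -ltr_pdivlMr.
Qed.

Lemma near_off w : ~~ (a <= w <= b) -> \forall z \near w, ~~ (a <= z <= b).
Proof.
move=> wab; have [e e0 he] := off_gap wab.
apply/nbhs_ballP; exists e => //= z; rewrite /ball/= => wz.
by apply/negP => /he; rewrite leNgt wz.
Qed.

Lemma Cauchy_derive f w : cont_on f -> ~~ (a <= w <= b) ->
  is_derive w 1 (Cauchy f) (- Cauchy (fun x => f x / (w - x)) w).
Proof.
move=> cf wab.
apply: (@is_derive_factor _ _ (fun z => - Cauchy (fun x => f x / (w - x)) z)).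
  near=> z; have zab : ~~ (a <= z <= b) by near: z; exact: near_off.
  by rewrite -(Cauchy_sub cf zab wab) addrC subrK.
apply: continuousN; apply: Cauchy_continuous => //; exact: cont_on_kernel.
Unshelve. all: by end_near.
Qed.
End CauchyTransform.

(** * Polynomials and Cauchy transforms at infinity *)

Section SmallAtInfinity.
Context {R : realType}.

(** A polynomial with positive leading coefficient eventually stays above that coefficient, whereas
    [C / y] tends to 0. *)
Lemma poly_small_eq0 (P : {poly R}) (C M : R) :
  (forall y, M < y -> `|P.[y]| <= C / y) -> P = 0.
Proof.
wlog lP : P / 0 <= lead_coef P.
  move=> H hP; have [/H|lP] := leP 0 (lead_coef P); first exact.
  apply/eqP; rewrite -oppr_eq0; apply/eqP; apply: H.
    by rewrite lead_coefN oppr_ge0 ltW.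
  by move=> y /hP; rewrite hornerN normrN.
move=> hP; apply/eqP; rewrite -lead_coef_eq0 eq_le lP andbT leNgt; apply/negP => l0.
have [n hn] := polyrcf.poly_pinfty_gt_lc l0.
pose y := `|n| + `|M| + `|C| / lead_coef P + 1.
have Cl : 0 <= `|C| / lead_coef P by rewrite divr_ge0.
have ny : n <= y by have := ler_norm n; have := normr_ge0 M; rewrite /y; lra.
have My : M < y by have := ler_norm M; have := normr_ge0 n; rewrite /y; lra.
have y0 : 0 < y by have := normr_ge0 M; have := normr_ge0 n; rewrite /y; lra.
have := le_trans (hn y ny) (le_trans (ler_norm _) (hP y My)).
rewrite ler_pdivlMr// => h.
have : lead_coef P * y <= `|C| by apply: (le_trans h); exact: ler_norm.
rewrite mulrC -ler_pdivlMr// leNgt => /negP; apply.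
by rewrite /y; have := normr_ge0 M; have := normr_ge0 n; lra.
Qed.

(** The polynomials in the Hermite-Padé conditions have complex coefficients; on the real axis,
    where everything else is real, this replaces them by real ones. *)
Lemma Re_poly_real (P : {poly R[i]}) : exists Q : {poly R},
  forall y : R, complex.Re P.[y%:C] = Q.[y].
Proof.
elim/poly_ind: P => [|P [u v] [Q hQ]].
  by exists 0 => y; rewrite !horner0.
exists (Q * 'X + u%:P) => y; rewrite !hornerMXaddC -hQ.
by case: (P.[_]) => p q /=; rewrite mulr0 subr0.
Qed.

Variables (mu : {finite_measure set R -> \bar R}) (a b : R).
Hypothesis mu_ab : mu (~` `[a, b]) = 0%E.

Lemma Cauchy_decay g : cont_on a b g -> exists C M : R,
  forall y, M < y -> [/\ 0 < y, ~~ (a <= y <= b) & `|Cauchy mu g y| <= C / y].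
Proof.
move=> cg; have [B B0 hB] := Cauchy_bounded mu_ab cg.
(* Beyond 2|b| the distance from y to the segment is at least y/2, whence the factor 2. *)
exists (B * 2), (2 * `|b|) => y hy.
have := ler_norm b; have := normr_ge0 b => b0 bb.
have y0 : 0 < y by lra.
split => //; first by rewrite negb_and -!ltNge; apply/orP; right; lra.
have -> : B * 2 / y = B / (y / 2) by field; lra.
apply: hB; first by lra.
by move=> x /andP[_ xb]; apply: le_trans (ler_norm _); lra.
Qed.

(* Induction on p by replacing g with x g: y \hat g(y) - \hat{x g}(y) is the constant
   \int g, which is small at infinity, hence zero. *)
Lemma Cauchy_small_orth p g (C M : R) : cont_on a b g ->
  (forall y, M < y -> `|Cauchy mu g y| <= C / y ^+ p.+1) ->
  forall P : {poly R}, (size P <= p)%N ->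
  Rintegral mu setT (fun x => g x * P.[x]) = 0.
Proof.
elim: p g M => [|p IH] g M cg hg P sP.
  have /size_poly_leq0P -> := sP.
  by rewrite -[RHS](Rint0 mu); apply: (Rint_ext mu_ab) => x _; rewrite horner0 mulr0.
have cgx : cont_on a b (fun x => g x * x).
  by apply: cont_onM => // x _; exact: cvg_id.
have [C1 [M1 h1]] := Cauchy_decay cg.
have [C2 [M2 h2]] := Cauchy_decay cgx.
pose M' := Num.max (Num.max M 1) (Num.max M1 M2).
have g0 : Rintegral mu setT g = 0.
  apply/eqP; rewrite -polyC_eq0; apply/eqP.
  apply: (@poly_small_eq0 _ (`|C| + C2) M') => y.
  rewrite !gt_max => /andP[/andP[My y1] /andP[/h1[y0 yab _] /h2[_ _ c2]]].
  rewrite hornerC.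
  have -> : Rintegral mu setT g = y * Cauchy mu g y - Cauchy mu (fun x => g x * x) y.
    by rewrite (Cauchy_mulX mu_ab)// opprB addrC subrK.
  apply: (le_trans (ler_normB _ _)); rewrite mulrDl; apply: lerD => //.
  rewrite normrM (gtr0_norm y0) mulrC -ler_pdivlMr// -mulrA -expr2.
  apply: (le_trans (hg y My)).
  apply: (@le_trans _ _ (`|C| / y ^+ p.+2)).
    by apply: ler_wpM2r; [rewrite invr_ge0 exprn_ge0// ltW|exact: ler_norm].
  apply: ler_wpM2l => //; rewrite -exprVn expr2 exprS.
  rewrite ler_wpM2l ?invr_ge0 ?(ltW y0)// exprS.
  rewrite -[leRHS]mulr1; apply: ler_wpM2l; first by rewrite invr_ge0 ltW.
  by rewrite exprn_ile1// ?invr_ge0 ?(ltW y0)// invf_le1// ltW.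
have hgx y : M' < y -> `|Cauchy mu (fun x => g x * x) y| <= C / y ^+ p.+1.
  rewrite !gt_max => /andP[/andP[My y1] /andP[/h1[y0 yab _] _]].
  rewrite (Cauchy_mulX mu_ab)// g0 subr0 normrM (gtr0_norm y0) mulrC -ler_pdivlMr//.
  by rewrite -mulrA -invfM -exprSr hg.
elim/poly_ind: P sP => [|P c _] sP.
  by rewrite -[RHS](Rint0 mu); apply: (Rint_ext mu_ab) => x _; rewrite horner0 mulr0.
have sP' : (size P <= p)%N.
  move: sP; rewrite size_MXaddC; case: ifP => //; first by move=> /andP[/eqP ->]; rewrite size_poly0.
have cgP : cont_on a b (fun x => (g x * x) * P.[x]).
  by apply: cont_onM => //; exact: cont_on_poly.
rewrite (Rint_ext mu_ab (g := fun x => (g x * x) * P.[x] + c * g x)); last first.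
  by move=> x _; rewrite hornerMXaddC; ring.
rewrite (RintD mu_ab)//; last by apply: cont_onM => //; exact: cont_on_cst.
by rewrite (RintZ mu_ab)// g0 mulr0 addr0 (IH _ _ cgx hgx).
Qed.
End SmallAtInfinity.

(** * Passage from the complex plane to the real line *)

Section RealForms.
Context {R : realType}.
Variables (eps : nat -> R) (mu : nat -> {finite_measure set R -> \bar R}).

Fixpoint rpsi (Q : {poly R}) (k : nat) : R -> R :=
  if k is k'.+1 then fun z => eps k * Cauchy (mu k) (rpsi Q k') z else fun z => Q.[z].

(* [rshat d j] is \hat s_{j,j+d-1} on the real line, with the convention
   \hat s_{j,j-1} = 1. *)
Fixpoint rshat (d j : nat) : R -> R :=
  if d is d'.+1 then fun z => eps j * Cauchy (mu j) (rshat d' j.+1) z else fun=> 1.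

Lemma cint_real m (f : R -> R) : cint m (fun x => (f x)%:C) = (Rintegral m setT f)%:C.
Proof. by rewrite /cint /= Rint0. Qed.

Lemma ctrans_real i (g : R[i] -> R[i]) (h : R -> R) :
  (forall x : R, g x%:C = (h x)%:C) ->
  forall x : R, ctrans eps mu i g x%:C = (eps i * Cauchy (mu i) h x)%:C.
Proof.
move=> gh x; rewrite /ctrans.
have -> : (fun t : R => g t%:C / (x%:C - t%:C)) = (fun t => (h t / (x - t))%:C).
  by apply/funext => t; rewrite gh rmorphM fmorphV rmorphB.
by rewrite cint_real rmorphM.
Qed.

Lemma PsiS Q k : Psi eps mu Q k.+1 = ctrans eps mu k.+1 (Psi eps mu Q k).
Proof.
rewrite /Psi; have -> : iota 1 k.+1 = iota 1 k ++ [:: k.+1] by rewrite -(addn1 k) iotaD addn1 add1n.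
by rewrite foldl_cat.
Qed.

Lemma Psi_real Q k (x : R) : Psi eps mu Q k x%:C = (rpsi Q k x)%:C.
Proof.
elim: k x => [|k IH] x.
  by rewrite /Psi /= /cpoly horner_map.
by rewrite PsiS /=; exact: ctrans_real.
Qed.

Lemma shat_real d j (x : R) :
  foldr (fun i g => ctrans eps mu i g) (fun _ => 1) (iota j d) x%:C = (rshat d j x)%:C.
Proof. by elim: d j x => [|d IH] j x //=; exact: ctrans_real. Qed.

(** With W(x) = |z - x|^2, the kernel 1/(z - x) has real part (Re z - x)/W(x) and imaginary part -Im
    z/W(x). As the density and the measure are real, both integrals vanish separately. *)
Lemma Psi_nonreal Q k (z : R[i]) : complex.Im z != 0 -> Psi eps mu Q k.+1 z = 0 ->
  eps k.+1 != 0 ->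
  let W x := (complex.Re z - x) ^+ 2 + complex.Im z ^+ 2 in
  Rintegral (mu k.+1) setT (fun x => rpsi Q k x * (complex.Re z - x) / W x) = 0 /\
  Rintegral (mu k.+1) setT (fun x => rpsi Q k x * - complex.Im z / W x) = 0.
Proof.
move=> vz H e0 W; move: H; rewrite PsiS /ctrans => /eqP.
rewrite mulf_eq0 => /orP[/eqP[e]|/eqP[r0 i0]].
  by rewrite e eqxx in e0.
have W0 x : W x != 0.
  by rewrite gt_eqF// ltr_wpDl ?sqr_ge0// exprn_even_gt0.
have E x : Psi eps mu Q k x%:C / (z - x%:C) =
    Complex (rpsi Q k x * (complex.Re z - x) / W x) (rpsi Q k x * - complex.Im z / W x).
  rewrite Psi_real; move: (W0 x); rewrite /W; case: z vz {W W0 r0 i0} => u v /= v0 W0.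
  apply/eqP; rewrite eq_complex /= subr0; apply/andP; split; apply/eqP.
    by rewrite mul0r subr0 mulrA.
  by rewrite mul0r addr0 !mulrN mulNr mulrA.
split.
  by rewrite -[RHS]r0; congr (Rintegral _ _ _); apply/funext => x; rewrite E.
by rewrite -[RHS]i0; congr (Rintegral _ _ _); apply/funext => x; rewrite E.
Qed.

End RealForms.

(** * From the Hermite-Padé conditions to orthogonality *)

Section Orthogonality.
Context {R : realType}.
Variables (m : nat) (a b eps : nat -> R) (mu : nat -> {finite_measure set R -> \bar R}).
Hypothesis Nik : Nikishin_system m a b eps mu.
Local Notation rpsi := (rpsi eps mu).
Local Notation rshat := (rshat eps mu).
Implicit Types (Q P W : {poly R}) (p : nat -> nat).

(** The first disjunct encodes that Delta_0 is empty. *)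
Definition off k x := (k == 0)%N || ~~ (a k <= x <= b k).

Lemma Nik_conull k : (0 < k <= m)%N -> mu k (~` `[a k, b k]) = 0%E.
Proof. by move=> /Nik.1[_ _ /msupport_conull]. Qed.

Lemma Nik_eps k : (0 < k <= m)%N -> eps k * eps k = 1.
Proof. by move=> /Nik.1[[]-> _ _ _ _]; rewrite ?mulrNN mulr1. Qed.

Lemma Nik_eps_neq0 k : (0 < k <= m)%N -> eps k != 0.
Proof.
by move=> /Nik_eps e; apply: contra_eq_neq e => ->; rewrite mul0r eq_sym oner_neq0.
Qed.

Lemma Nik_le k : (0 < k <= m)%N -> a k <= b k.
Proof.
move=> /Nik.1[_ _ sab sa sb]; have := sab _ sa.
by rewrite /= in_itv/= => /andP[].
Qed.

Lemma Nik_off k x : (k < m)%N -> a k.+1 <= x <= b k.+1 -> off k x.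
Proof.
move=> km /andP[ax xb]; rewrite /off; case: k km ax xb => //= k km ax xb.
rewrite negb_and -!ltNge; apply/orP.
have [h|h] := Nik.2 k.+1 km.
  by right; exact: lt_le_trans ax.
by left; exact: le_lt_trans h.
Qed.

Lemma Nik_off_right k x : (0 < k < m)%N -> a k <= x <= b k -> ~~ (a k.+1 <= x <= b k.+1).
Proof.
move=> /andP[k0 km] xk; apply/negP => /(Nik_off km); rewrite /off xk orbF.
by case: k k0 {km xk}.
Qed.

Lemma rpsi_continuous Q k x : (k <= m)%N -> off k x -> {for x, continuous (rpsi Q k)}.
Proof.
elim: k x => [|k IH] x km; first by move=> _; exact: continuous_horner.
rewrite /off /= => xo; apply: continuousM; first exact: cst_continuous.
apply: (Cauchy_continuous (Nik_conull _) _ xo) => //.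
by move=> y /(Nik_off km) yo; apply: IH => //; exact: ltnW.
Qed.

Lemma rpsi_cont_on Q k : (k < m)%N -> cont_on (a k.+1) (b k.+1) (rpsi Q k).
Proof. by move=> km x /(Nik_off km); apply: rpsi_continuous; exact: ltnW. Qed.

Lemma rshat_cont_on d j : (0 < j)%N -> (j + d <= m)%N ->
  cont_on (a j) (b j) (rshat d j.+1).
Proof.
elim: d j => [|d IH] j j0 jd; first exact: cont_on_cst.
rewrite addnS in jd; have jm : (j < m)%N by apply: leq_ltn_trans jd; rewrite leq_addr.
move=> x xj; apply: continuousM; first exact: cst_continuous.
apply: (Cauchy_continuous (Nik_conull _)) => //.
  by apply: IH => //; rewrite addSn.
by apply: Nik_off_right => //; rewrite j0.
Qed.

(** Up to the sign [eps], this is orthogonality of Psi_k with respect to s_{k+1,j}: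
    [rshat (j - k.+1) k.+2] is \hat s_{k+2,j}. For j = k+1 this factor is 1, which leaves plain
    orthogonality. *)
Definition orth_mixed p Q k := forall j, (k < j <= m)%N ->
  forall P, (size P <= p j)%N ->
  Rintegral (mu k.+1) setT (fun x => rpsi Q k x * (rshat (j - k.+1) k.+2 x * P.[x])) = 0.

(** At real points, Q \hat s_{1,j} minus the real part of P_j is the Cauchy transform of Q ds_{1,j}
    plus a polynomial [T]. The transform decays, so [T] is small at infinity and vanishes; the
    transform is then O(1/y^(p_j+1)), which yields orthogonality. *)
Lemma HP_orth_mixed0 p Q : HP_typeII m eps mu p Q -> orth_mixed p Q 0.
Proof.
move=> [_ [_ hHP]] j jm P sP; have [Pc [C [M hM]]] := hHP j jm.
have [Pr hPr] := Re_poly_real Pc.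
have m0 : (0 < m)%N by case/andP: jm => h; exact: leq_trans.
have c1 := Nik_conull (ltac:(by rewrite m0) : (0 < 1 <= m)%N).
set h := rshat (j - 1) 2.
have ch : cont_on (a 1) (b 1) h.
  by apply: rshat_cont_on => //; rewrite subnKC//; case/andP: jm.
have chQ : cont_on (a 1) (b 1) (fun x => h x * Q.[x]).
  by apply: cont_onM => //; exact: cont_on_poly.
have [S [_ hS]] := Cauchy_mul_poly c1 Q ch.
have [C1 [M1 hM1]] := Cauchy_decay c1 chQ.
have e1 := Nik_eps (ltac:(by rewrite m0) : (0 < 1 <= m)%N).
have ee : `|eps 1%N| = 1 by have [[]-> _ _ _ _] := Nik.1 1%N (ltac:(by rewrite m0)); rewrite ?normrN normr1.
(* The term with [S] arises from moving [Q] inside the Cauchy transform, [Pr] from the Hermite-Padé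
   condition. *)
pose T := eps 1%N *: S - Pr.
have key y : Num.max M (Num.max M1 0) < y ->
    `|eps 1%N * Cauchy (mu 1%N) (fun x => h x * Q.[x]) y + T.[y]| <= C / y ^+ (p j).+1.
  rewrite !gt_max => /andP[My /andP[/hM1[_ yab _] y0]].
  have ny : `|y%:C| = y%:C :> R[i].
    by rewrite normc_def /= expr0n /= addr0 sqrtr_sqr gtr0_norm.
  have := hM y%:C; rewrite ny ltcR => /(_ My).
  rewrite /cpoly horner_map /shat /= subn1 /=.
  have := shat_real eps mu j 1 y => ->.
  rewrite -rmorphM -rmorphXn -fmorphV -rmorphM /= => hle.
  rewrite -lecR; apply: (le_trans _ hle).
  apply: (le_trans _ (normc_ge_Re _)); rewrite lecR.
  rewrite raddfB /= hPr.
  have -> : rshat j 1 y = eps 1%N * Cauchy (mu 1%N) h y.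
    by rewrite -{1}(@subnK 1 j) ?addn1//; case/andP: jm.
  rewrite /T hornerD hornerN hornerZ hS//.
  rewrite le_eqVlt; apply/orP; left; apply/eqP; congr (`| _ |); ring.
have T0 : T = 0.
  apply: (@poly_small_eq0 _ _ (`|C| + C1) (Num.max (Num.max M (Num.max M1 0)) 1)) => y.
  rewrite gt_max => /andP[hy y1]; have := key y hy.
  move: hy; rewrite !gt_max => /andP[My /andP[/hM1[_ yab c1y] y0]] k1.
  have -> : T.[y] = (eps 1%N * Cauchy (mu 1%N) (fun x => h x * Q.[x]) y + T.[y]) -
    eps 1%N * Cauchy (mu 1%N) (fun x => h x * Q.[x]) y by ring.
  apply: (le_trans (ler_normB _ _)); rewrite mulrDl; apply: lerD.
    apply: (le_trans k1); apply: (@le_trans _ _ (`|C| / y ^+ (p j).+1)).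
      by apply: ler_wpM2r; [rewrite invr_ge0 exprn_ge0// ltW|exact: ler_norm].
    apply: ler_wpM2l => //; rewrite -exprVn exprS -[leRHS]mulr1.
    apply: ler_wpM2l; first by rewrite invr_ge0 ltW.
    by rewrite exprn_ile1// ?invr_ge0 ?(ltW y0)// invf_le1// ltW.
  by rewrite normrM ee mul1r.
have small y : Num.max M (Num.max M1 0) < y ->
    `|Cauchy (mu 1%N) (fun x => h x * Q.[x]) y| <= C / y ^+ (p j).+1.
  by move/key; rewrite T0 horner0 addr0 normrM ee mul1r.
rewrite -[RHS](Cauchy_small_orth c1 chQ small sP); apply: (Rint_ext c1) => x _ /=.
by rewrite /h; ring.
Qed.

(* Fubini turns the outer integral of P \hat s_{k+3,j} / (x - t) into a polynomial in t of
   degree < deg P plus a multiple of P \hat s_{k+2,j}; the first part is killed by the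
   orthogonality for the index k+1, and this is where p_j <= p_{k+1} + 1 is needed. *)
Lemma orth_mixedS p Q k : (forall i j, (0 < i < j)%N -> (j <= m)%N -> (p j <= (p i).+1)%N) ->
  (k.+1 < m)%N -> orth_mixed p Q k -> orth_mixed p Q k.+1.
Proof.
move=> hp km ok j /andP[kj jm] P sP.
have k1m : (k < m)%N by exact: ltnW.
have c1 := Nik_conull (k1m : (0 < k.+1 <= m)%N).
have c2 := Nik_conull (km : (0 < k.+2 <= m)%N).
set h := rshat (j - k.+2) k.+3.
have ch : cont_on (a k.+2) (b k.+2) h by apply: rshat_cont_on => //; rewrite subnKC.
have chP : cont_on (a k.+2) (b k.+2) (fun x => h x * P.[x]).
  by apply: cont_onM => //; exact: cont_on_poly.
have cf := rpsi_cont_on (Q := Q) k1m.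
have sep : b k.+1 < a k.+2 \/ b k.+2 < a k.+1 by exact: Nik.2.
have [S [sS hS]] := Cauchy_mul_poly c2 P ch.
have e2 := Nik_eps (km : (0 < k.+2 <= m)%N).
have ch' : cont_on (a k.+2) (b k.+2) (fun x => (h x * P.[x]) * rpsi Q k.+1 x).
  by apply: cont_onM => //; exact: rpsi_cont_on.
rewrite (Rint_ext c2 (g := fun x => eps k.+1 * ((h x * P.[x]) *
   Rintegral (mu k.+1) setT (fun t => rpsi Q k t / (x - t))))); last first.
  by move=> x _; rewrite /= /Cauchy; ring.
rewrite (RintZ c2); last first.
  move=> x xk; have [e0 E] : eps k.+1 != 0 /\ (fun x => (h x * P.[x]) * Rintegral (mu k.+1) setT
     (fun t => rpsi Q k t / (x - t))) = (fun x => (eps k.+1)^-1 * ((h x * P.[x]) * rpsi Q k.+1 x)).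
    have e0 := Nik_eps_neq0 (k1m : (0 < k.+1 <= m)%N).
    by split => //; apply/funext => y; rewrite /= /Cauchy; field.
  by rewrite E; apply: continuousM; [exact: cst_continuous|exact: ch'].
rewrite (Fubini_Cauchy c1 c2 sep cf chP).
(* The scaling of [P] by [eps k.+2] compensates the factor [eps k.+2] contained in \hat s_{k+2,j},
   the square of a sign being 1; the coefficient -1 reflects that the inner kernel is 1/(x - t),
   opposite to the Cauchy kernel at t. *)
rewrite (Rint_ext c1 (g := fun t => rpsi Q k t * S.[t] +
   -1 * (rpsi Q k t * (rshat (j - k.+1) k.+2 t * (eps k.+2 *: P).[t])))); last first.
  move=> t tk; have to : ~~ (a k.+2 <= t <= b k.+2) by apply: Nik_off_right.
  have -> : Rintegral (mu k.+2) setT (fun x => h x * P.[x] / (x - t)) =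
            - Cauchy (mu k.+2) (fun x => h x * P.[x]) t.
    rewrite -[RHS]mulN1r; apply: (etrans _ (RintZ c2 (-1) (cont_on_kernel chP to))).
    by apply: (Rint_ext c2) => x _; rewrite mulN1r -mulrN -invrN opprB.
  rewrite hS//; have -> : (j - k.+1)%N = (j - k.+2).+1 by rewrite subnSK.
  rewrite /= -/h hornerZ.
  have -> : eps k.+2 * Cauchy (mu k.+2) h t * (eps k.+2 * P.[t]) = (eps k.+2 * eps k.+2) * (P.[t] * Cauchy (mu k.+2) h t) by ring.
  by rewrite e2; ring.
have kj' : (k < j <= m)%N by rewrite (ltnW kj).
have cs : cont_on (a k.+1) (b k.+1) (rshat (j - k.+1) k.+2).
  by apply: rshat_cont_on => //; rewrite subnKC// ltnW.
rewrite (RintD c1); last 2 first.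
- by apply: cont_onM => //; exact: cont_on_poly.
- apply: cont_onM; first exact: cont_on_cst.
  by do 2 (apply: cont_onM => //); exact: cont_on_poly.
rewrite (RintZ c1); last by do 2 (apply: cont_onM => //); exact: cont_on_poly.
rewrite ok//; last by rewrite (leq_trans (size_scale_leq _ _)).
have kk : (k < k.+1 <= m)%N by rewrite leqnn.
have := ok k.+1 kk S; rewrite subnn => hS0.
rewrite mulr0 addr0 (Rint_ext c1 (g := fun x => rpsi Q k x * (1 * S.[x]))); last first.
  by move=> x _; rewrite mul1r.
rewrite hS0 ?mulr0//; apply: (leq_trans sS).
by rewrite -subn1 leq_subLR add1n (leq_trans sP)// hp.
Qed.

(** Together with [Q != 0] and the degree bound, this is what the rest of the proof retains of the
    Hermite-Padé conditions. It is linear in [Q] and passes to smaller indices. *)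
Definition orth p Q := forall k, (k < m)%N -> forall P, (size P <= p k.+1)%N ->
  Rintegral (mu k.+1) setT (fun x => rpsi Q k x * P.[x]) = 0.

Lemma HP_orth p Q : (forall i j, (0 < i < j)%N -> (j <= m)%N -> (p j <= (p i).+1)%N) ->
  HP_typeII m eps mu p Q -> orth p Q.
Proof.
move=> hp hQ k km P sP.
have ok : orth_mixed p Q k.
  elim: k km {P sP} => [|k IH] km; first exact: HP_orth_mixed0.
  by apply: orth_mixedS => //; apply: IH; exact: ltnW.
have := ok k.+1 (ltac:(by rewrite leqnn)) P sP; rewrite subnn => <-.
by apply: (Rint_ext (Nik_conull (km : (0 < k.+1 <= m)%N))) => x _; rewrite mul1r.
Qed.

End Orthogonality.

(** * Polynomial divisors of Psi_k *)

Lemma poly_taylor1 (R : idomainType) (P : {poly R}) (z : R) : exists q : {poly R},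
  (size q <= (size P).-1)%N /\ P = P.[z]%:P + q * ('X - z%:P).
Proof.
have /factor_theorem[q hq] : root (P - P.[z]%:P) z.
  by rewrite /root !hornerE subrr.
exists q; split; last by rewrite -hq addrC subrK.
have [->|q0] := eqVneq q 0; first by rewrite size_poly0.
have := size_Mmonic q0 (monicXsubC z); rewrite -hq size_XsubC addn2 /= => sq.
have s1 : (size (P - P.[z]%:P)%R <= maxn (size P) 1)%N.
  rewrite (leq_trans (size_polyD _ _))// size_polyN geq_max leq_maxl/=.
  by rewrite (leq_trans (size_polyC_leq1 _))// leq_maxr.
have sP : (1 < size P)%N.
  rewrite ltnNge; apply/negP => /size1_polyC Pc.
  move: hq; rewrite Pc hornerC subrr => /eqP; rewrite eq_sym mulf_eq0 (negPf q0).
  by rewrite polyXsubC_eq0.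
by move: s1; rewrite sq (maxn_idPl (ltnW sP)); case: (size P) sP.
Qed.

Lemma finite_roots (R : realType) (P : {poly R}) : P != 0 -> finite_set [set x | root P x].
Proof.
move=> P0; apply: contrapT => inf.
have [B BS MB] := infinite_set_fset (size P) inf.
have := max_poly_roots P0 (_ : all (root P) (finmap.enum_fset B)) (finmap.fset_uniq B).
by rewrite ltnNge MB => h; have : false by apply: h; apply/allP => x xB; exact: BS.
Qed.

Section Divisors.
Context {R : realType}.
Variables (m : nat) (a b eps : nat -> R) (mu : nat -> {finite_measure set R -> \bar R}).
Hypothesis Nik : Nikishin_system m a b eps mu.
Variables (p : nat -> nat) (Q : {poly R}).
Local Notation psi := (rpsi eps mu Q).
Local Notation off := (off a b).
Implicit Types (P W : {poly R}) (G : R -> R).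

(* [divides k W G]: the real polynomial W divides Psi_k off Delta_k, with quotient G,
   multiplicities included. For k > 0 this is expressed by the orthogonality of
   Psi_(k-1)/W to all polynomials of degree < p_k + deg W. *)
Definition divides k W G := if k is k'.+1 then
  [/\ forall x, a k <= x <= b k -> W.[x] != 0,
      forall P, (size P < p k + size W)%N ->
        Rintegral (mu k) setT (fun x => psi k' x / W.[x] * P.[x]) = 0 &
      G = fun z => eps k * Cauchy (mu k) (fun x => psi k' x / W.[x]) z]
  else exists g, Q = W * g /\ G = fun z => g.[z].

Lemma divides_neq0 k W G : Q != 0 -> (k <= m)%N -> divides k W G -> W != 0.
Proof.
move=> Q0; case: k => [|k] km /=.
  by move=> [g [Qg _]]; apply: contra_neq Q0 => W0; rewrite Qg W0 mul0r.
move=> [W0 _ _]; apply/eqP => We; have := W0 (a k.+1).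
by rewrite lexx (Nik_le Nik)// We horner0 eqxx => /(_ isT).
Qed.

Lemma divides1 k : orth m eps mu p Q -> (k <= m)%N -> divides k 1 (psi k).
Proof.
move=> oQ; case: k => [|k] km /=; first by exists Q; rewrite mul1r.
have c := Nik_conull Nik (km : (0 < k.+1 <= m)%N).
split.
- by move=> x _; rewrite hornerC oner_neq0.
- move=> P; rewrite size_poly1 addn1 ltnS => sP.
  by rewrite -[RHS](oQ k km P sP); apply: (Rint_ext c) => x _; rewrite hornerC divr1.
- apply/funext => z; congr (_ * _); apply: (Cauchy_ext c) => x _.
  by rewrite hornerC divr1.
Qed.

Lemma divides_cont k W G : (k < m)%N -> divides k.+1 W G ->
  cont_on (a k.+1) (b k.+1) (fun x => psi k x / W.[x]).
Proof.
move=> km [W0 _ _]; apply: cont_on_divp => //.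
exact: (rpsi_cont_on Nik).
Qed.

(** Writing W(x) = W(z) + q(x)(x - z) splits W(z)/(W(x)(z - x)) into 1/(z - x) + q(x)/W(x). The
    second term contributes nothing, by the orthogonality of Psi_(k-1)/W to [q]. *)
Lemma divides_eq k W G z : (k <= m)%N -> divides k W G -> off k z ->
  psi k z = W.[z] * G z.
Proof.
case: k => [|k] km; first by move=> [g [-> ->]] _; rewrite /= hornerM.
move=> dW; have cW := divides_cont km dW; case: dW => W0 oW ->.
have c := Nik_conull Nik (km : (0 < k.+1 <= m)%N).
rewrite /off /= => zo.
have [q [sq Wq]] := poly_taylor1 W z.
rewrite mulrCA; congr (_ * _); rewrite /Cauchy -(RintZ c); last exact: cont_on_kernel.
rewrite -[RHS]addr0 -[X in _ = _ + X](mulr0 (-1)).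
have sqW : (size q < p k.+1 + size W)%N.
  apply: (leq_ltn_trans sq).
  have : W != 0.
    apply/eqP => We; have := W0 (a k.+1).
    by rewrite lexx (Nik_le Nik)// We horner0 eqxx => /(_ isT).
  rewrite -size_poly_gt0; case: (size W) => // s _ /=.
  by rewrite addnS ltnS leq_addl.
rewrite -(oW q sqW) -(RintZ c); last by apply: cont_onM => //; exact: cont_on_poly.
rewrite -(RintD c); last 2 first.
- by apply: cont_onM; [exact: cont_on_cst|exact: cont_on_kernel].
- by apply: cont_onM; [exact: cont_on_cst|apply: cont_onM => //; exact: cont_on_poly].
apply: (Rint_ext c) => x xab.
have Wx : W.[x] = W.[z] + q.[x] * (x - z) by rewrite {1}Wq !hornerE.
have zx := off_sub_neq0 zo xab; have := W0 x xab; rewrite Wx => Wx0.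
by field; rewrite zx Wx0.
Qed.

Lemma divides_continuous k W G z : (k <= m)%N -> divides k W G -> off k z ->
  {for z, continuous G}.
Proof.
case: k => [|k] km; first by move=> [g [_ ->]] _; exact: continuous_horner.
move=> dW; have cW := divides_cont km dW; case: dW => _ _ ->.
rewrite /off /= => zo; apply: continuousM; first exact: cst_continuous.
exact: (Cauchy_continuous (Nik_conull Nik (km : (0 < k.+1 <= m)%N))).
Qed.

(** Writing P(x) = P(w) + q(x)(x - w), the integral of Psi_(k-1) P/(W (X - w)) splits into one with
    [q], zero by orthogonality since [q] has lower degree, and a multiple of the Cauchy transform at
    w, zero because G(w) = 0. *)
Lemma divides_root k W G w : (k <= m)%N -> divides k W G -> off k w -> G w = 0 ->
  exists G', divides k (W * ('X - w%:P)) G' /\ forall z, off k z -> G z = (z - w) * G' z.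
Proof.
case: k => [|k] km.
  move=> [g [Qg ->]] _ /eqP/factor_theorem[h gh]; exists (fun z => h.[z]); split.
    by exists h; split => //; rewrite Qg gh mulrAC mulrA.
  by move=> z _; rewrite gh !hornerE mulrC.
move=> dW; have cW := divides_cont km dW; have W_eq := divides_eq km dW.
case: dW => W0 oW GE.
have c := Nik_conull Nik (km : (0 < k.+1 <= m)%N).
have e0 := Nik_eps_neq0 Nik (km : (0 < k.+1 <= m)%N).
rewrite /off /= => wo Gw.
have C0 : Cauchy (mu k.+1) (fun x => psi k x / W.[x]) w = 0.
  by move/eqP: Gw; rewrite GE mulf_eq0 (negPf e0) => /eqP.
have W0' x : a k.+1 <= x <= b k.+1 -> (W * ('X - w%:P)).[x] != 0.
  move=> xab; rewrite hornerM hornerXsubC mulf_neq0 ?W0//.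
  by rewrite -opprB oppr_eq0 (off_sub_neq0 wo xab).
have We : W != 0.
  apply/eqP => We; have := W0 (a k.+1).
  by rewrite lexx (Nik_le Nik)// We horner0 eqxx => /(_ isT).
eexists; split; first split; [by []| |by []|].
- move=> P; rewrite size_Mmonic ?monicXsubC// size_XsubC addn2 /= => sP.
  have [q [sq Pq]] := poly_taylor1 P w.
  have sqW : (size q < p k.+1 + size W)%N.
    apply: (leq_ltn_trans sq); move: sP; rewrite addnS ltnS.
    case: (size P) => //= _; by rewrite addn_gt0 size_poly_gt0 We orbT.
  have := oW q sqW; move/eqP.
  rewrite -[X in X == _]addr0 -[X in _ + X == _](mulr0 (- P.[w])) -C0.
  rewrite /Cauchy -(RintZ c); last exact: cont_on_kernel.
  rewrite -(RintD c); last 2 first.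
  + by apply: cont_onM => //; exact: cont_on_poly.
  + by apply: cont_onM; [exact: cont_on_cst|exact: cont_on_kernel].
  move/eqP => <-; apply: (Rint_ext c) => x xab.
  have Px : P.[x] = P.[w] + q.[x] * (x - w) by rewrite {1}Pq !hornerE.
  rewrite Px hornerM hornerXsubC.
  have wx := off_sub_neq0 wo xab; have Wx := W0 x xab.
  have xw : x - w != 0 by rewrite -opprB oppr_eq0.
  by field; rewrite wx Wx xw.
- move=> z zo; rewrite GE mulrCA; congr (_ * _).
  rewrite -[LHS]subr0 -{1}C0 (Cauchy_sub c cW zo wo) mulrC; congr (_ * _).
  have cWw : cont_on (a k.+1) (b k.+1) (fun x => psi k x / W.[x] / (w - x)).
    exact: cont_on_kernel.
  rewrite -mulN1r -(CauchyZ c _ cWw zo); apply: (Cauchy_ext c) => x xab.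
  rewrite hornerM hornerXsubC.
  have wx := off_sub_neq0 wo xab; have Wx := W0 x xab.
  have xw : x - w != 0 by rewrite -opprB oppr_eq0.
  by field; rewrite wx Wx xw.
Qed.

Lemma divides_roots k W G (s : seq R) : (k <= m)%N -> divides k W G -> uniq s ->
  (forall x, x \in s -> off k x /\ G x = 0) ->
  exists G', divides k (W * \prod_(x <- s) ('X - x%:P)) G'.
Proof.
move=> km; elim: s W G => [|w s IH] W G dW; first by rewrite big_nil mulr1; exists G.
move=> /= /andP[ws us] hs.
have [wo Gw] := hs w (mem_head _ _).
have [G1 [dW1 hG1]] := divides_root km dW wo Gw.
have [|G2 dW2] := IH _ _ dW1 us; last by exists G2; rewrite big_cons mulrA.
move=> x xs; have [xo Gx] : off k x /\ G x = 0 by apply: hs; rewrite inE xs orbT.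
split => //.
(* Distinctness of the points makes the remaining ones zeros of the new quotient. *)
move: Gx; rewrite hG1// => /eqP; rewrite mulf_eq0 subr_eq0 => /orP[/eqP xw|/eqP//].
by rewrite -xw xs in ws.
Qed.

(** The alternative for a single sign change yields either a zero of [W] or a polynomial of degree
    0, whose value serves as [t]. *)
Lemma nonvanishing_sign W (c d : R) : c <= d -> (forall x, c <= x <= d -> W.[x] != 0) ->
  exists t : R, forall x, c <= x <= d -> 0 < t * W.[x].
Proof.
move=> cd W0; have cW : cont_on c d (fun x => W.[x]) by exact: cont_on_poly.
have [sW|[P [P0 sP hP]]] := sign_changes_or_poly cd cW (ltn0Sn 0).
  have [s [_ ss hs]] := sign_changes_zeros cW sW.
  case: s ss hs => // x s _ hs.
  by have [xcd Wx] := hs x (mem_head _ _); have := W0 x xcd; rewrite Wx eqxx.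
have /size1_polyC Pc := sP; exists P`_0 => x xcd.
rewrite lt_neqAle eq_sym mulf_neq0 ?W0//=; last by rewrite -polyC_eq0 -Pc.
by have := hP x xcd; rewrite Pc hornerC mulrC coefC eqxx.
Qed.

(* The second alternative, arbitrarily many zeros, is excluded for Q <> 0 only
   afterwards, by [zeros_bound]. *)
Lemma zeros_dichotomy k W G : (k < m)%N -> divides k.+1 W G ->
  sign_changes_ge (psi k) (a k.+1) (b k.+1) (p k.+1 + (size W).-1) \/
  forall M, exists s : seq R, [/\ uniq s, size s = M &
    forall x, x \in s -> a k.+1 <= x <= b k.+1 /\ psi k x = 0].
Proof.
move=> km dW; have cW := divides_cont km dW; case: dW => W0 oW _.
have c := Nik_conull Nik (km : (0 < k.+1 <= m)%N).
have ab := Nik_le Nik (km : (0 < k.+1 <= m)%N).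
set D := (p k.+1 + (size W).-1)%N.
have [->|D0] := posnP D; first by left; exists (fun=> a k.+1); split => // i _; rewrite lexx.
have cf : cont_on (a k.+1) (b k.+1) (psi k) by exact: (rpsi_cont_on Nik).
have [|[P [P0 sP hP]]] := sign_changes_or_poly ab cf D0; [by left|right].
have [t ht] := nonvanishing_sign ab W0.
(* [D] is p_(k+1) + deg W, so deg P < D is exactly the range of the orthogonality clause. *)
have sPW : (size P < p k.+1 + size W)%N.
  apply: (leq_ltn_trans sP); rewrite /D; have : W != 0.
    by apply/eqP => We; have := ht (a k.+1); rewrite lexx ab We horner0 mulr0 ltxx => /(_ isT).
  by rewrite -size_poly_gt0; case: (size W) => // s _; rewrite addnS.
have cWP : cont_on (a k.+1) (b k.+1) (fun x => psi k x / W.[x] * P.[x]).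
  by apply: cont_onM => //; exact: cont_on_poly.
have F0 x : a k.+1 <= x <= b k.+1 -> 0 <= t * (psi k x / W.[x] * P.[x]).
  move=> xab; have -> : t * (psi k x / W.[x] * P.[x]) =
      (t * W.[x]) * (psi k x * P.[x]) * W.[x]^-1 ^+ 2.
    by have := W0 x xab => Wx; field.
  by rewrite mulr_ge0 ?sqr_ge0// mulr_ge0 ?hP// ltW// ht.
have I0 : Rintegral (mu k.+1) setT (fun x => t * (psi k x / W.[x] * P.[x])) = 0.
  by rewrite (RintZ c)// oW// mulr0.
have ct : cont_on (a k.+1) (b k.+1) (fun x => t * (psi k x / W.[x] * P.[x])).
  by apply: cont_onM => //; exact: cont_on_cst.
(* A nonnegative continuous integrand of integral zero vanishes on the support. The support is
   infinite and [P] has finitely many roots, so infinitely many zeros of Psi_k remain. *)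
have supp0 := Rint_eq0 c ct F0 I0.
have [_ inf sab _ _] := Nik.1 k.+1 (km : (0 < k.+1 <= m)%N).
have inf' := infinite_setD inf (finite_roots P0).
move=> M; have [B BS MB] := infinite_set_fset M inf'.
exists (take M (finmap.enum_fset B)); split.
- by rewrite take_uniq// finmap.fset_uniq.
- by rewrite size_take; case: ltngtP MB.
- move=> x /mem_take xB; have [sx /= /negP Px] := BS x xB.
  have xab : a k.+1 <= x <= b k.+1 by have := sab _ sx; rewrite /= in_itv.
  split => //; have /eqP := supp0 x sx xab.
  rewrite !mulf_eq0 invr_eq0 (negPf (W0 x xab)) orbF.
  have := ht x xab; have [->|t0] := eqVneq t 0; first by rewrite mul0r ltxx.
  by move=> _; rewrite -/(root P x) (negPf Px) orbF/= => /eqP.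
Qed.

End Divisors.

(** * Counting zeros and excluding nonreal and double ones *)

Lemma size_prod_roots (R : idomainType) (W : {poly R}) (s : seq R) : W != 0 ->
  (size (W * \prod_(x <- s) ('X - x%:P))%R = size W + size s)%N.
Proof.
move=> W0; rewrite size_Mmonic ?monic_prod_XsubC// size_prod_XsubC addnS /=.
by rewrite addnC.
Qed.

Section ZeroCount.
Context {R : realType}.
Variables (m : nat) (a b eps : nat -> R) (mu : nat -> {finite_measure set R -> \bar R}).
Hypothesis Nik : Nikishin_system m a b eps mu.
Variables (p : nat -> nat) (Q : {poly R}).
Hypotheses (Q0 : Q != 0) (oQ : orth m eps mu p Q).
Local Notation psi := (rpsi eps mu Q).
Local Notation off := (off a b).
Local Notation divides := (divides a b eps mu p Q).
Implicit Types (P W : {poly R}) (G : R -> R).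

Lemma dichotomy_zeros k W G : (k < m)%N -> divides k.+1 W G ->
  exists s : seq R, [/\ uniq s, size s = (p k.+1 + (size W).-1)%N &
    forall x, x \in s -> a k.+1 <= x <= b k.+1 /\ psi k x = 0].
Proof.
move=> km dW; have [sc|] := zeros_dichotomy Nik km dW; last exact.
by apply: sign_changes_zeros sc; exact: (rpsi_cont_on Nik).
Qed.

(** Descent on [k]: a divisor [W] of Psi_k yields p_k + deg W zeros of Psi_(k-1), whose linear
    factors form a divisor of that degree. Each step moves p_k into the degree, and at k = 0 the
    divisor divides [Q]. *)
Lemma divides_size k W G : (k <= m)%N -> divides k W G ->
  (\sum_(1 <= i < k.+1) p i + size W <= size Q)%N.
Proof.
elim: k W G => [|k IH] W G km dW.
  case: dW => g [Qg _]; rewrite big_geq// add0n Qg.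
  have : W * g != 0 by rewrite -Qg.
  rewrite mulf_eq0 negb_or => /andP[W0 g0]; rewrite size_mul//.
  by rewrite -size_poly_gt0 in g0; case: (size g) g0 => // s _; rewrite addnS leq_addr.
have [s [us ss hs]] := dichotomy_zeros km dW.
have W0 := divides_neq0 Nik Q0 km dW.
have [|G' dW'] := divides_roots Nik (ltnW km) (divides1 Nik oQ (ltnW km)) us.
  by move=> x /hs[xab ->]; split => //; exact: (Nik_off Nik).
have := IH _ _ (ltnW km) dW'; rewrite size_prod_roots ?oner_neq0// size_poly1 ss.
have -> : (\sum_(1 <= i < k.+2) p i = \sum_(1 <= i < k.+1) p i + p k.+1)%N.
  by rewrite big_nat_recr.
by rewrite -addnA add1n -addnS prednK// size_poly_gt0.
Qed.

Lemma zeros_bound k (s : seq R) : (k <= m)%N -> uniq s ->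
  (forall x, x \in s -> off k x /\ psi k x = 0) ->
  (\sum_(1 <= i < k.+1) p i + size s < size Q)%N.
Proof.
move=> km us hs; have [G' dW'] := divides_roots Nik km (divides1 Nik oQ km) us hs.
have := divides_size km dW'; rewrite size_prod_roots ?oner_neq0// size_poly1.
by rewrite addnCA add1n.
Qed.

(** The same descent started at Psi_m with the divisor 1: going from Psi_(j+1) to Psi_j raises the
    degree by p_(j+1). *)
Lemma divides_tail k : (k <= m)%N ->
  exists W G, divides k W G /\ size W = (\sum_(k.+1 <= i < m.+1) p i).+1.
Proof.
move=> km; rewrite -(subKn km); elim: (m - k)%N (leq_subr k m) => [_|d IH dm].
  rewrite subn0; exists 1, (psi m); split; first exact: (divides1 Nik oQ).
  by rewrite size_poly1 big_geq.
have := IH (ltnW dm); have -> : (m - d)%N = (m - d.+1).+1 by rewrite subnSK.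
set j := (m - d.+1)%N; have jm : (j < m)%N by rewrite /j ltn_subrL (leq_ltn_trans _ dm).
move=> [W [G [dW sW]]].
have [s [us ss hs]] := dichotomy_zeros jm dW.
have [|G' dW'] := divides_roots Nik (ltnW jm) (divides1 Nik oQ (ltnW jm)) us.
  by move=> x /hs[xab ->]; split => //; exact: (Nik_off Nik).
exists (1 * \prod_(x <- s) ('X - x%:P)), G'; split => //.
rewrite size_prod_roots ?oner_neq0// size_poly1 ss sW add1n /=.
by rewrite [in RHS]big_ltn.
Qed.

Lemma rpsi_sign_changes k : (k < m)%N ->
  sign_changes_ge (psi k) (a k.+1) (b k.+1) (\sum_(k.+1 <= i < m.+1) p i).
Proof.
move=> km; have [W [G [dW sW]]] := divides_tail km.
have [|inf] := zeros_dichotomy Nik km dW.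
  by rewrite sW /= [in X in _ -> X]big_ltn.
(* As many zeros as [size Q] already contradict [zeros_bound]. *)
have [s [us ss hs]] := inf (size Q).
have : (\sum_(1 <= i < k.+1) p i + size s < size Q)%N.
  apply: zeros_bound => //; first exact: ltnW.
  by move=> x /hs[xab ->]; split => //; exact: (Nik_off Nik).
by rewrite ss ltnNge leq_addl.
Qed.

Lemma size_lower : (absidx m p < size Q)%N.
Proof.
have [W [G [dW sW]]] := divides_tail (leq0n m).
by have := divides_size (leq0n m) dW; rewrite big_geq// add0n sW.
Qed.

Lemma absidx_split k : (k <= m)%N ->
  absidx m p = (\sum_(1 <= i < k.+1) p i + \sum_(k.+1 <= i < m.+1) p i)%N.
Proof. by move=> km; rewrite /absidx -big_cat_nat. Qed.

Lemma no_nonneg_quadratic k W G : (k < m)%N -> (size Q <= (absidx m p).+2)%N ->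
  divides k W G -> size W = 3%N -> (forall x, 0 <= W.[x]) -> False.
Proof.
move=> km sQ dW sW W0.
have [x [xab hx]] := rpsi_sign_changes km.
have cG : cont_on (a k.+1) (b k.+1) G.
  by move=> y /(Nik_off Nik km) yo; exact: (divides_continuous Nik (ltnW km) dW).
have sG : sign_changes_ge G (a k.+1) (b k.+1) (\sum_(k.+1 <= i < m.+1) p i).
  exists x; split => // i iN; have [xx pp] := hx i iN; split => //.
  have eqi j : (j <= \sum_(k.+1 <= i < m.+1) p i)%N -> psi k (x j) = W.[x j] * G (x j).
    move=> jN; apply: (divides_eq Nik (ltnW km) dW).
    by apply: (Nik_off Nik km); exact: xab.
  move: pp; rewrite !eqi ?(ltnW iN)// mulrACA.
  have := mulr_ge0 (W0 (x i)) (W0 (x i.+1)); rewrite le_eqVlt => /predU1P[<-|w0].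
    by rewrite mul0r ltxx.
  by rewrite pmulr_rlt0.
have [s [us ss hs]] := sign_changes_zeros cG sG.
have [|G' dW'] := divides_roots Nik (ltnW km) dW us.
  by move=> y /hs[yab ->]; split => //; exact: (Nik_off Nik).
have Wn0 : W != 0 by rewrite -size_poly_gt0 sW.
have := divides_size (ltnW km) dW'.
rewrite (size_prod_roots _ Wn0) sW ss addnCA -(absidx_split (ltnW km)).
by move=> /leq_trans/(_ sQ); rewrite addnC addn3 ltnn.
Qed.

(** The derivative at the zero [w] is the value there of the quotient by X - w; if it vanishes, the
    nonnegative polynomial (X - w)^2 divides Psi_k. *)
Lemma no_double_zero k w : (k < m)%N -> (size Q <= (absidx m p).+2)%N ->
  off k w -> psi k w = 0 -> is_derive w 1 (psi k) 0 -> False.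
Proof.
move=> km sQ wo pw dpw.
have [G [dW hG]] := divides_root Nik (ltnW km) (divides1 Nik oQ (ltnW km)) wo pw.
have Gw : G w = 0.
  suff dG : is_derive w 1 (psi k) (G w) by case: dG => _ <-; case: dpw.
  apply: is_derive_factor; last exact: (divides_continuous Nik (ltnW km) dW wo).
  near=> z; rewrite pw add0r mulrC; apply: hG.
  near: z; move: wo; rewrite /off; case: (k == 0)%N => //= wo; last exact: near_off.
  by apply: nearW.
have [G' [dW' _]] := divides_root Nik (ltnW km) dW wo Gw.
apply: (no_nonneg_quadratic km sQ dW').
  by rewrite !size_Mmonic ?monicXsubC ?mulf_neq0 ?oner_neq0 ?polyXsubC_eq0// size_poly1 size_XsubC.
by move=> x; rewrite !hornerM hornerXsubC hornerC mul1r -expr2 sqr_ge0.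
Unshelve. all: by end_near.
Qed.

Lemma rpsi_derivable k w : (k <= m)%N -> off k w -> exists d, is_derive w 1 (psi k) d.
Proof.
case: k => [|k] km wo.
  exists Q^`().[w]; apply: DeriveDef; first exact: derivable_horner.
  by rewrite -derive1E derivE.
exists (eps k.+1 * - Cauchy (mu k.+1) (fun x => psi k x / (w - x)) w).
apply: is_deriveZ; apply: (Cauchy_derive (Nik_conull Nik (km : (0 < k.+1 <= m)%N))) => //.
exact: (rpsi_cont_on Nik).
Qed.

Lemma zeros_real k (z : R[i]) : (k < m)%N -> (size Q <= (absidx m p).+2)%N ->
  Psi eps mu Q k z = 0 -> complex.Im z = 0.
Proof.
move=> km sQ Pz; apply/eqP; apply/negPn/negP => vz.
(* This is the product of X - z and X - \bar z, positive on the real line; it remains to see that it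
   divides Psi_k. *)
pose W : {poly R} := ('X - (complex.Re z)%:P) ^+ 2 + (complex.Im z ^+ 2)%:P.
have WE x : W.[x] = (x - complex.Re z) ^+ 2 + complex.Im z ^+ 2 by rewrite /W !hornerE.
have sW : size W = 3%N.
  rewrite /W size_polyDl; first by rewrite size_exp_XsubC.
  by rewrite size_exp_XsubC (leq_ltn_trans (size_polyC_leq1 _)).
have W0 x : 0 < W.[x].
  by rewrite WE ltr_wpDl ?sqr_ge0// exprn_even_gt0.
suff [G dW] : exists G, divides k W G.
  by apply: (no_nonneg_quadratic km sQ dW sW) => x; exact: ltW.
have Wn0 : W != 0 by rewrite -size_poly_gt0 sW.
have rem P : exists r0 r1 : R, P = P %/ W * W + (r1 *: 'X + r0%:P).
  exists (P %% W)`_0, (P %% W)`_1; rewrite {1}(divp_eq P W); congr (_ + _).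
  have sr : (size (P %% W)%R <= 2)%N by rewrite -ltnS -sW ltn_modp.
  apply/polyP => -[|[|i]]; rewrite coefD coefZ coefX coefC /= ?mulr0 ?mulr1 ?add0r ?addr0//.
  by rewrite nth_default// (leq_trans sr).
case: k km Pz => [|k] km Pz.
  (* The remainder of [Q] modulo [W] is real, of degree at most 1, and vanishes at the nonreal point
     z, so it is zero. *)
  suff QW : Q = Q %/ W * W by exists (fun x => (Q %/ W).[x]), (Q %/ W); rewrite mulrC.
  have [r0 [r1 Qr]] := rem Q; move: Pz; rewrite /Psi /= /cpoly {1}Qr.
  rewrite rmorphD rmorphM /= hornerD hornerM.
  have -> : (map_poly (real_complex R) W).[z] = 0.
    rewrite /W rmorphD rmorphXn rmorphB /= map_polyX !map_polyC /= hornerD horner_exp.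
    rewrite hornerXsubC hornerC; case: (z) => u v /=.
    by apply/eqP; rewrite eq_complex /= expr2 /=; apply/andP; split; apply/eqP; ring.
  rewrite mulr0 add0r rmorphD /= map_polyZ map_polyX map_polyC /= hornerD hornerZ hornerX hornerC.
  move: vz; case: (z) => u v /= v0 /eqP; rewrite eq_complex /= => /andP[/eqP h0 /eqP h1].
  have r10 : r1 = 0.
    by move/eqP: h1; rewrite mul0r !addr0 mulf_eq0 (negPf v0) orbF => /eqP.
  have r00 : r0 = 0 by move: h0; rewrite r10 !mul0r subr0 add0r.
  by rewrite {1}Qr r10 r00 scale0r !addr0.
clearbody W; have k1m : (k < m)%N := ltnW km.
have c := Nik_conull Nik (k1m : (0 < k.+1 <= m)%N).
have e0 := Nik_eps_neq0 Nik (k1m : (0 < k.+1 <= m)%N).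
have [Ire Iim] := Psi_nonreal vz Pz e0.
have Wx x : (complex.Re z - x) ^+ 2 + complex.Im z ^+ 2 = W.[x].
  by rewrite WE -sqrrN opprB.
have Wx0 x : W.[x] != 0 by rewrite gt_eqF.
have cf : cont_on (a k.+1) (b k.+1) (psi k) by exact: (rpsi_cont_on Nik).
have cl : cont_on (a k.+1) (b k.+1) (fun x => psi k x * (complex.Re z - x) / W.[x]).
  apply: cont_on_divp => //; apply: cont_onM => // x _.
  by apply: continuousB; [exact: cst_continuous|exact: cvg_id].
have ci : cont_on (a k.+1) (b k.+1) (fun x => psi k x * - complex.Im z / W.[x]).
  by apply: cont_on_divp => //; apply: cont_onM => //; exact: cont_on_cst.
eexists; split; [by move=> x _| |by []] => P; rewrite sW => sP.
(* The quotient of [P] by [W] is in the range of orthogonality; the linear remainder is treated by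
   the real and imaginary parts of the equation at z. *)
have [r0 [r1 Pr]] := rem P.
have sq : (size (P %/ W)%R <= p k.+1)%N.
  by rewrite size_divp// sW leq_subLR addnC -ltnS -addnS.
(* These solve A (Re z - x) - B Im z = r1 x + r0. *)
set A := - r1; set B := - (r0 + r1 * complex.Re z) / complex.Im z.
rewrite (Rint_ext c (g := fun x => psi k x * (P %/ W).[x] +
   (A * (psi k x * (complex.Re z - x) / W.[x]) +
    B * (psi k x * - complex.Im z / W.[x])))); last first.
  move=> x _; have Px : P.[x] = (P %/ W).[x] * W.[x] + (r1 * x + r0).
    by rewrite {1}Pr hornerD hornerM hornerD hornerZ hornerX hornerC.
  rewrite Px /A /B; have := Wx0 x => wx.
  by field; rewrite wx vz.
rewrite (RintD c); last 2 first.
- by apply: cont_onM => //; exact: cont_on_poly.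
- by apply: cont_onD; apply: cont_onM => //; exact: cont_on_cst.
rewrite (RintD c); last 2 first.
- by apply: cont_onM => //; exact: cont_on_cst.
- by apply: cont_onM => //; exact: cont_on_cst.
rewrite (RintZ c)// (RintZ c)// (oQ k1m sq).
have -> : Rintegral (mu k.+1) setT (fun x => psi k x * (complex.Re z - x) / W.[x]) = 0.
  by rewrite -[RHS]Ire; apply: (Rint_ext c) => x _; rewrite Wx.
have -> : Rintegral (mu k.+1) setT (fun x => psi k x * - complex.Im z / W.[x]) = 0.
  by rewrite -[RHS]Iim; apply: (Rint_ext c) => x _; rewrite Wx.
by rewrite !mulr0 !addr0.
Qed.
End ZeroCount.

(** * Linear combinations and interlacing *)

Lemma zero_between (R : realType) (f g : R -> R) (x y : R) : x < y ->
  (forall z, x <= z <= y -> exists d, is_derive z 1 f d) ->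
  (forall z, x <= z <= y -> exists d, is_derive z 1 g d) ->
  (forall z df dg s t, x <= z <= y -> is_derive z 1 f df -> is_derive z 1 g dg ->
     s * f z + t * g z = 0 -> s * df + t * dg = 0 -> s = 0 /\ t = 0) ->
  f x = 0 -> f y = 0 -> exists w, g w = 0 /\ x < w < y.
Proof.
(* If g has no zero on the segment, Rolle's theorem for f/g gives a point c at which g(c) f - f(c) g
   has a double zero, against [indep]. *)
move=> xy Df Dg indep fx fy; apply: contrapT => ng.
have nz z : x <= z <= y -> g z != 0.
  move=> zxy; apply/eqP => gz.
  have [zx|zx] := eqVneq z x; [|have [zy|zy] := eqVneq z y].
  - have [df hf] := Df z zxy; have [dg hg] := Dg z zxy.
    (* At a common zero, the combination dg f - df g has a double zero, so df = dg = 0; but then f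
       itself has one. *)
    have [] := indep z df dg dg (- df) zxy hf hg.
    + by rewrite gz zx fx !mulr0 addr0.
    + by ring.
    move=> dg0 df0; have [] := indep z df dg 1 0 zxy hf hg.
    + by rewrite gz zx fx !mulr0 addr0.
    + by move/eqP: df0; rewrite oppr_eq0 => /eqP ->; ring.
    by move/eqP; rewrite oner_eq0.
  - have [df hf] := Df z zxy; have [dg hg] := Dg z zxy.
    have [] := indep z df dg dg (- df) zxy hf hg.
    + by rewrite gz zy fy !mulr0 addr0.
    + by ring.
    move=> dg0 df0; have [] := indep z df dg 1 0 zxy hf hg.
    + by rewrite gz zy fy !mulr0 addr0.
    + by move/eqP: df0; rewrite oppr_eq0 => /eqP ->; ring.
    by move/eqP; rewrite oner_eq0.
  - apply: ng; exists z; split => //; case/andP: zxy => h1 h2.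
    by rewrite !lt_neqAle h1 h2 zy eq_sym zx.
have Dh z : x <= z <= y -> exists df dg, [/\ is_derive z 1 f df, is_derive z 1 g dg &
    is_derive z 1 (fun t => f t * (g t)^-1) (f z *: (- (g z) ^- 2 *: dg) + (g z)^-1 *: df)].
  move=> zxy; have [df hf] := Df z zxy; have [dg hg] := Dg z zxy.
  exists df, dg; split => //; apply: is_deriveM.
  exact: (is_deriveV (nz z zxy)).
have hc : {within `[x, y], continuous (fun t => f t * (g t)^-1)}.
  apply: cont_on_within => z zxy; have [df [dg [_ _ hD]]] := Dh z zxy.
  by apply: differentiable_continuous; apply/derivable1_diffP.
have [||c] := Rolle xy _ hc.
- move=> z; rewrite in_itv/= => /andP[h1 h2].
  by have [df [dg [_ _ hD]]] := Dh z (ltac:(by rewrite !ltW)).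
- by rewrite fx fy !mul0r.
rewrite in_itv/= => /andP[h1 h2] hD0.
have cxy : x <= c <= y by rewrite !ltW.
have [df [dg [hf hg hD]]] := Dh c cxy.
have gc := nz c cxy.
have E : f c *: (- (g c) ^- 2 *: dg) + (g c)^-1 *: df = 0.
  by case: hD => _ <-; case: hD0.
have [] := indep c df dg (g c) (- f c) cxy hf hg.
- by ring.
- have -> : g c * df + - f c * dg = (g c) ^+ 2 * (f c *: (- (g c) ^- 2 *: dg) + (g c)^-1 *: df).
    by rewrite /GRing.scale /=; field.
  by rewrite E mulr0.
by move=> g0; rewrite g0 eqxx in gc.
Qed.

Section Combinations.
Context {R : realType}.
Variables (m : nat) (a b eps : nat -> R) (mu : nat -> {finite_measure set R -> \bar R}).
Hypothesis Nik : Nikishin_system m a b eps mu.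
Local Notation psi := (rpsi eps mu).
Local Notation off := (off a b).

Lemma rpsi_comb (Q1 Q2 : {poly R}) (s t : R) k x : (k <= m)%N -> off k x ->
  psi (s *: Q1 + t *: Q2) k x = s * psi Q1 k x + t * psi Q2 k x.
Proof.
elim: k x => [|k IH] x km; first by rewrite /= hornerD !hornerZ.
rewrite /off /= => xo; have c := Nik_conull Nik (km : (0 < k.+1 <= m)%N).
have c1 := rpsi_cont_on Nik (Q := Q1) km; have c2 := rpsi_cont_on Nik (Q := Q2) km.
rewrite (Cauchy_ext c (g := fun x => s * psi Q1 k x + t * psi Q2 k x)); last first.
  by move=> y /(Nik_off Nik km); apply: IH; exact: ltnW.
rewrite (CauchyD c)// ?(CauchyZ c)//; first by ring.
  by apply: cont_onM => //; exact: cont_on_cst.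
by apply: cont_onM => //; exact: cont_on_cst.
Qed.

Lemma orth_comb p (Q1 Q2 : {poly R}) (s t : R) : orth m eps mu p Q1 -> orth m eps mu p Q2 ->
  orth m eps mu p (s *: Q1 + t *: Q2).
Proof.
move=> o1 o2 k km P sP; have c := Nik_conull Nik (km : (0 < k.+1 <= m)%N).
have c1 := rpsi_cont_on Nik (Q := Q1) km; have c2 := rpsi_cont_on Nik (Q := Q2) km.
have cP : cont_on (a k.+1) (b k.+1) (fun x => P.[x]) by exact: cont_on_poly.
rewrite (Rint_ext c (g := fun x => s * (psi Q1 k x * P.[x]) + t * (psi Q2 k x * P.[x]))); last first.
  by move=> x /(Nik_off Nik km) xo; rewrite /= rpsi_comb ?(ltnW km)//; ring.
have c1P := cont_onM c1 cP; have c2P := cont_onM c2 cP.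
rewrite (RintD c); last 2 first.
- by apply: cont_onM => //; exact: cont_on_cst.
- by apply: cont_onM => //; exact: cont_on_cst.
by rewrite !(RintZ c)// o1// o2// !mulr0 addr0.
Qed.

Lemma orth_le p q (Q : {poly R}) : (forall i, (q i <= p i)%N) ->
  orth m eps mu p Q -> orth m eps mu q Q.
Proof. by move=> qp o k km P sP; apply: o => //; exact: leq_trans sP (qp _). Qed.

(** The sign changes already provide p_(k+1) + ... + p_m zeros in Delta_(k+1), and deg Q <= |p|
    leaves no room for another one. *)
Lemma zeros_in_next p (Q : {poly R}) k x : Q != 0 -> orth m eps mu p Q ->
  (size Q <= (absidx m p).+1)%N -> (k < m)%N -> off k x -> psi Q k x = 0 ->
  a k.+1 <= x <= b k.+1.
Proof.
move=> Q0 oQ sQ km xo px.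
have [s [us ss hs]] := sign_changes_zeros (rpsi_cont_on Nik (Q := Q) km)
  (rpsi_sign_changes Nik Q0 oQ km).
have [/hs[]//|xs] := boolP (x \in s).
have : (\sum_(1 <= i < k.+1) p i + size (x :: s) < size Q)%N.
  apply: (zeros_bound Nik Q0 oQ (ltnW km)) => //=; first by rewrite xs.
  move=> y; rewrite inE => /predU1P[->//|/hs[yab ->]].
  by split => //; exact: (Nik_off Nik).
rewrite /= ss addnS -(absidx_split p (ltnW km)).
by move=> /leq_trans/(_ sQ); rewrite ltnn.
Qed.

Lemma off_in_Delta k (x : R) : off k x <-> ~ in_Delta a b k x%:C.
Proof.
rewrite /off /in_Delta /=; split; first by case: k => [|k] /= => [_ []|/negP h [_ []]].
case: k => [//|k] /= h; apply/negP => h1; apply: h; split => //.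
Qed.

Lemma zeros_out_real (Q : {poly R}) k (x : R) :
  zeros_out a b k (Psi eps mu Q k) x%:C <-> off k x /\ psi Q k x = 0.
Proof.
rewrite /zeros_out /= Psi_real off_in_Delta; split => -[h1 h2]; split => //.
  by case: h2.
by rewrite h2.
Qed.

End Combinations.

(** * Multi-indices and conclusion *)

Lemma incr_at_sum (n : nat -> nat) l i j :
  (\sum_(i <= k < j) incr_at n l k = \sum_(i <= k < j) n k + (i <= l < j))%N.
Proof.
have -> : (\sum_(i <= k < j) incr_at n l k = \sum_(i <= k < j) (n k + (k == l)))%N.
  by apply: eq_bigr => k _; rewrite /incr_at; case: eqP => _; rewrite ?addn1 ?addn0.
rewrite big_split /=; congr addn.
have -> : (\sum_(i <= k < j) (k == l) = \sum_(i <= k < j | k == l) 1)%N.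
  by rewrite [in RHS]big_mkcond; apply: eq_bigr => k _; case: eqP.
by rewrite big_nat1_eq; case: ifP.
Qed.

Lemma nonincreasing_chain (n : nat -> nat) m :
  (forall i, (1 <= i < m)%N -> (n i.+1 <= n i)%N) ->
  forall i j, (0 < i <= j)%N -> (j <= m)%N -> (n j <= n i)%N.
Proof.
move=> hn i j /andP[i0 ij]; rewrite -(subnKC ij); elim: (j - i)%N => [|d IH] dm.
  by rewrite addn0.
rewrite addnS in dm *; apply: leq_trans (IH (ltnW dm)).
by apply: hn; rewrite dm andbT (leq_trans i0) ?leq_addr.
Qed.

Theorem theorem4 (R : realType) (m : nat) (a b eps : nat -> R)
  (mu : nat -> {finite_measure set R -> \bar R})
  (n : nat -> nat) (l : nat) (Qn Qnl : {poly R}) :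
  Nikishin_system m a b eps mu ->
  (forall i, (1 <= i < m)%N -> (n i.+1 <= n i)%N) ->
  (1 <= l <= m)%N ->
  HP_typeII m eps mu n Qn ->
  HP_typeII m eps mu (incr_at n l) Qnl ->
  forall k, (k < m)%N ->
    let N := (\sum_(k.+1 <= i < m.+1) n i)%N in
    let F := Psi eps mu Qnl k in
    [/\ (forall s : seq R[i], uniq s -> (forall z, z \in s -> zeros_out a b k F z) ->
           (size s <= N.+1)%N),
        sign_changes_ge (fun x => complex.Re (F x%:C)) (a k.+1) (b k.+1) N,
        (forall z, zeros_out a b k F z ->
           complex.Im z = 0 /\
           exists d : R, is_derive (complex.Re z) 1 (fun x : R => complex.Re (F x%:C)) d /\ d != 0) &
        interlace (zeros_out a b k (Psi eps mu Qn k)) (zeros_out a b k F)].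
Proof.
move=> Nik hn lm HPn HPl k km N F.
have chain := nonincreasing_chain hn.
have oN : orth m eps mu n Qn.
  apply: (HP_orth Nik) HPn => i j /andP[i0 ij] jm; apply: leqW; apply: chain => //.
  by rewrite i0 ltnW.
(* The index n^l may fail to be nonincreasing, but it still satisfies p_j <= p_i + 1 for i < j. *)
have oL : orth m eps mu (incr_at n l) Qnl.
  apply: (HP_orth Nik) HPl => i j /andP[i0 ij] jm.
  have nji : (n j <= n i)%N by apply: chain => //; rewrite i0 ltnW.
  by rewrite /incr_at; case: eqP => _; case: eqP => _; rewrite ?ltnS ?leqW.
(* Both polynomials now lie in one linear space: degree at most |n| + 1 and orthogonality for the
   index n. *)
have oLn : orth m eps mu n Qnl.
  by apply: orth_le oL => i; rewrite /incr_at; case: eqP.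
have [Qn0 [sQn _]] := HPn; have [Ql0 [sQl _]] := HPl.
have absL : absidx m (incr_at n l) = (absidx m n).+1.
  by rewrite /absidx incr_at_sum lm addn1.
(* The degrees are exactly |n| and |n| + 1; being different, they keep every nontrivial combination
   nonzero. *)
have szn : size Qn = (absidx m n).+1.
  by apply/eqP; rewrite eqn_leq sQn (size_lower Nik Qn0 oN).
have szl : size Qnl = (absidx m n).+2.
  by apply/eqP; rewrite eqn_leq -absL sQl (size_lower Nik Ql0 oL).
have sQl2 : (size Qnl <= (absidx m n).+2)%N by rewrite szl.
have km' := ltnW km.
have Fre : (fun x : R => complex.Re (F x%:C)) = rpsi eps mu Qnl k.
  by apply/funext => x; rewrite /F Psi_real.
have toreal Q z : Q != 0 -> orth m eps mu n Q -> (size Q <= (absidx m n).+2)%N ->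
    zeros_out a b k (Psi eps mu Q k) z ->
    [/\ complex.Im z = 0, off a b k (complex.Re z) & rpsi eps mu Q k (complex.Re z) = 0].
  move=> Q0 oQ sQ hz; have vz := zeros_real Nik Q0 oQ km sQ hz.2.
  have E : z = (complex.Re z)%:C by case: z vz {hz} => u v /= ->.
  by move: hz; rewrite {1}E => /zeros_out_real[].
(* No nontrivial combination of Psi_(n,k) and Psi_(n^l,k) has a double zero off Delta_k;
   disjointness of the zeros and interlacing rest on this. *)
have indep x df dg s t : off a b k x -> is_derive x 1 (rpsi eps mu Qn k) df ->
    is_derive x 1 (rpsi eps mu Qnl k) dg ->
    s * rpsi eps mu Qn k x + t * rpsi eps mu Qnl k x = 0 -> s * df + t * dg = 0 ->
    s = 0 /\ t = 0.
  move=> xo hf hg h1 h2; apply: contrapT => st.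
  pose Q := s *: Qn + t *: Qnl.
  have Q0 : Q != 0.
    rewrite -size_poly_gt0; have [t0|t0] := eqVneq t 0.
      have s0 : s != 0 by apply/eqP => s0; exact: st.
      by rewrite /Q t0 scale0r addr0 size_scale// szn.
    have E : (size (s *: Qn) < size (t *: Qnl))%N.
      by rewrite (size_scale _ t0) szl ltnS -szn size_scale_leq.
    by rewrite /Q addrC (size_polyDl E) size_scale// szl.
  have sQ : (size Q <= (absidx m n).+2)%N.
    rewrite (leq_trans (size_polyD _ _))// geq_max !(leq_trans (size_scale_leq _ _))//.
    by rewrite szn.
  apply: (no_double_zero Nik Q0 (orth_comb Nik s t oN oLn) km sQ xo).
    by rewrite (rpsi_comb Nik)// h1.
  have H : is_derive x 1 (fun z => s *: rpsi eps mu Qn k z + t *: rpsi eps mu Qnl k z) 0.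
    by rewrite -h2; apply: is_deriveD.
  apply: near_eq_is_derive H => //; near=> z; rewrite -(rpsi_comb Nik)//.
  near: z; move: xo; rewrite /off; case: (k == 0)%N => //= xo; last exact: near_off.
  exact: nearW.
(* Each polynomial is taken here with its own index, for which its degree is |p|. All zeros then lie
   in Delta_(k+1), so the segment between two of them avoids Delta_k. *)
have inn Q x : [\/ Q = Qn | Q = Qnl] -> off a b k x -> rpsi eps mu Q k x = 0 ->
    a k.+1 <= x <= b k.+1.
  move=> [->|->]; first exact: (zeros_in_next Nik Qn0 oN).
  exact: (zeros_in_next Nik Ql0 oL).
have offmid x y z : a k.+1 <= x <= b k.+1 -> a k.+1 <= y <= b k.+1 -> x <= z <= y -> off a b k z.
  move=> /andP[ax _] /andP[_ yb] /andP[xz zy]; apply: (Nik_off Nik km).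
  by rewrite (le_trans ax)// (le_trans zy).
split.
(* The zeros being real, taking real parts is injective on them and reduces the count to
   [zeros_bound]. *)
- move=> s us hs; have hs' z : z \in s -> _ := fun zs => toreal Qnl z Ql0 oLn sQl2 (hs z zs).
  have uR : uniq (map (@complex.Re R) s).
    rewrite map_inj_in_uniq// => z1 z2 /hs'[i1 _ _] /hs'[i2 _ _].
    by case: z1 z2 i1 i2 => [u1 v1] [u2 v2] /= -> -> ->.
  have hR x : x \in map (@complex.Re R) s -> off a b k x /\ rpsi eps mu Qnl k x = 0.
    by move=> /mapP[z /hs'[_ h1 h2] ->].
  have := zeros_bound Nik Ql0 oLn km' uR hR.
  by rewrite size_map szl (absidx_split n km') ltnS -addnS leq_add2l.
- by rewrite Fre; exact: (rpsi_sign_changes Nik Ql0 oLn km).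
- move=> z hz; have [vz zo pz] := toreal Qnl z Ql0 oLn sQl2 hz; split => //.
  rewrite Fre; have [d hd] := rpsi_derivable Nik Qnl km' zo.
  exists d; split => //; apply/eqP => d0; rewrite d0 in hd.
  exact: (no_double_zero Nik Ql0 oLn km sQl2 zo pz hd).
have sQn2 : (size Qn <= (absidx m n).+2)%N by rewrite szn.
split.
- by move=> z /(toreal Qn z Qn0 oN sQn2)[].
- by move=> z /(toreal Qnl z Ql0 oLn sQl2)[].
- move=> z /(toreal Qn z Qn0 oN sQn2)[_ zo p1] /(toreal Qnl z Ql0 oLn sQl2)[_ _ p2].
  have [df hf] := rpsi_derivable Nik Qn km' zo.
  have [dg hg] := rpsi_derivable Nik Qnl km' zo.
  (* At a common zero the combination with coefficients [dg] and [- df] has a double zero, so both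
     derivatives vanish; then Psi_(n,k) alone has one. *)
  have [] := indep _ df dg dg (- df) zo hf hg.
  + by rewrite p1 p2 !mulr0 addr0.
  + by ring.
  move=> dg0 /eqP; rewrite oppr_eq0 => /eqP df0.
  have [] := indep _ df dg 1 0 zo hf hg.
  + by rewrite p1 p2 !mulr0 addr0.
  + by rewrite df0; ring.
  by move/eqP; rewrite oner_eq0.
- move=> x y /zeros_out_real[xo px] /zeros_out_real[yo py] xy.
  have xin := inn Qn x (or_introl erefl) xo px; have yin := inn Qn y (or_introl erefl) yo py.
  have mid z := offmid x y z xin yin.
  have [||z df dg s t zxy|w [gw wxy]] := @zero_between _ (rpsi eps mu Qn k) (rpsi eps mu Qnl k) x y xy _ _ _ px py.
  + by move=> z /mid zo; exact: (rpsi_derivable Nik).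
  + by move=> z /mid zo; exact: (rpsi_derivable Nik).
  + exact: indep (mid z zxy).
  exists w; split => //; apply/zeros_out_real; split => //; apply: mid.
  by case/andP: wxy => *; rewrite !ltW.
- move=> x y /zeros_out_real[xo px] /zeros_out_real[yo py] xy.
  have xin := inn Qnl x (or_intror erefl) xo px; have yin := inn Qnl y (or_intror erefl) yo py.
  have mid z := offmid x y z xin yin.
  have [||z df dg s t zxy hf hg h1 h2|w [gw wxy]] := @zero_between _ (rpsi eps mu Qnl k) (rpsi eps mu Qn k) x y xy _ _ _ px py.
  + by move=> z /mid zo; exact: (rpsi_derivable Nik).
  + by move=> z /mid zo; exact: (rpsi_derivable Nik).
  + by rewrite addrC in h1; rewrite addrC in h2; have [] := indep _ _ _ _ _ (mid z zxy) hg hf h1 h2.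
  exists w; split => //; apply/zeros_out_real; split => //; apply: mid.
  by case/andP: wxy => *; rewrite !ltW.
Unshelve. all: by end_near.
Qed.
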